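(* Consider the extremum seeking system with feedback law $u_{i,1}(J(x),\tau)=\sqrt{2\omega_iJ(x)}\cos(\ln J(x)+\omega_i\tau)$, $u_{i,2}(J(x),\tau)=\sqrt{2\omega_iJ(x)}\sin(\ln J(x)+\omega_i\tau)$ when $J(x)>0$, and $u_{i,1}=u_{i,2}=0$ when $J(x)\le0$, written in shifted coordinates $\tilde x=x-x^\star$: $$\dot{\tilde x}=b_0(\tilde x+x^\star)+\varepsilon^{-1}\sum_{i=1}^r\sum_{j=1}^2b_{i,j}u_{i,j}(J(\tilde x+x^\star),\tau),\qquad\dot\tau=\varepsilon^{-2}.$$ Suppose the Excitation Assumption holds with constant $\gamma$ and the Regularity Assumption holds with constant $\kappa_3$, with $\gamma>\kappa_3$, and suppose $J$ is a radially unbounded $\mathcal{C}^2$ function for which there is $\alpha_J\in\mathcal{K}$ with $\alpha_J(|x-x^\star|)^2|x-x^\star|^2\le|\nabla J(x)|^2$ for all $x\in\mathbb{R}^n$. Then: (a) there exists $\Delta>0$ such that the origin $\tilde x=0$ is $\Delta$-uniformly globally ultimately bounded for this system; (b) if $J^\star\ge0$, the origin $\tilde x=0$ is uniformly globally practically asymptotically stable for this system.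
   Context: $|\cdot|$ is the Euclidean norm; $\mathcal{K},\mathcal{KL}$ standard comparison-function classes. Data: $n\ge1$, $r$ a positive integer with $r\ge n/2$, vectors $b_{i,j}\in\mathbb{R}^n$ ($i=1,\dots,r$, $j=1,2$), distinct positive rationals $\omega_1,\dots,\omega_r$, a map $b_0:\mathbb{R}^n\to\mathbb{R}^n$, a cost $J:\mathbb{R}^n\to\mathbb{R}$ with $J^\star:=\inf_xJ(x)>-\infty$ attained at a unique $x^\star$, and a parameter $\varepsilon>0$. Excitation Assumption: there is $\gamma>0$ with $\sum_{i=1}^r\sum_{j=1}^2(b_{i,j}^\top v)^2\ge\gamma|v|^2$ for all $v\in\mathbb{R}^n$. Regularity Assumption: (a) $J(x)>J(x^\star)$ for $x\ne x^\star$; (b) $\nabla J(x)=0$ iff $x=x^\star$; (c) there is $L_J>0$ with $|\nabla^2J(x)|\le L_J$ for all $x$; (d) there is $\kappa_3>0$ with $|b_0(x)|\le\kappa_3|\nabla J(x)|$ for all $x$; (e) there is $L_0>0$ with $|b_0(x_1)-b_0(x_2)|\le L_0|x_1-x_2|$ for all $x_1,x_2$. Solutions: for initial $(\tilde x_0,\tau_0)\in\mathbb{R}^n\times\mathbb{R}_{\ge0}$, a $\mathcal{C}^1$ function on $[0,t_s)$, $t_s\in(0,\infty]$, satisfying the ODE and initial condition. The origin is $\Delta$-uniformly globally ultimately bounded if there exist $\beta\in\mathcal{KL}$ and $\varepsilon^*>0$ such that for all $\varepsilon\in(0,\varepsilon^* )$ every solution from every initial condition is defined for all $t\ge0$ and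 satisfies $|\tilde x(t)|\le\beta(|\tilde x_0|,t)+\Delta$ for all $t\ge0$. It is uniformly globally practically asymptotically stable if there is $\beta\in\mathcal{KL}$ such that for every $\nu>0$ there is $\varepsilon^*>0$ such that for all $\varepsilon\in(0,\varepsilon^* )$ every solution is defined for all $t\ge0$ and satisfies $|\tilde x(t)|\le\beta(|\tilde x_0|,t)+\nu$. *)

(* Defs.v *)
From HB Require Import structures.
From mathcomp Require Import all_boot all_order all_algebra.
From mathcomp Require Import all_classical all_reals all_analysis.
Set Implicit Arguments. Unset Strict Implicit. Unset Printing Implicit Defensive.
Import Order.TTheory GRing.Theory Num.Theory numFieldNormedType.Exports.
Local Open Scope ring_scope.
Local Open Scope classical_set_scope.

Definition enorm (R : realType) (n : nat) (v : 'rV[R]_n) : R :=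
  Num.sqrt (\sum_(i < n) v 0 i ^+ 2).
Definition dotv (R : realType) (n : nat) (u v : 'rV[R]_n) : R :=
  \sum_(i < n) u 0 i * v 0 i.

Definition evec (R : realType) (n : nat) (i : 'I_n) : 'rV[R]_n := delta_mx 0 i.
Definition partial (R : realType) (n : nat) (i : 'I_n) (f : 'rV[R]_n -> R) :
  'rV[R]_n -> R := fun x => 'D_(evec R i) f x.
Definition grad (R : realType) (n : nat) (f : 'rV[R]_n -> R) (x : 'rV[R]_n) :
  'rV[R]_n := \row_i partial i f x.
Definition hess_norm (R : realType) (n : nat) (f : 'rV[R]_n -> R) (x : 'rV[R]_n) : R :=
  Num.sqrt (\sum_(i < n) \sum_(j < n) (partial j (partial i f) x) ^+ 2).

(* C^2: all first and second partial derivatives exist everywhere and the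
   second partials are continuous (hence so are the first ones). *)
Definition C2 (R : realType) (n : nat) (f : 'rV[R]_n -> R) : Prop :=
  (forall (i : 'I_n) x, derivable f x (evec R i)) /\
  (forall (i j : 'I_n) x, derivable (partial i f) x (evec R j)) /\
  (forall (i j : 'I_n), continuous (partial j (partial i f))).

Definition radially_unbounded (R : realType) (n : nat) (f : 'rV[R]_n -> R) : Prop :=
  forall M : R, exists rho : R, forall x, rho <= enorm x -> M <= f x.

Definition classK (R : realType) (a : R -> R) : Prop :=
  a 0 = 0 /\ {within [set s : R | 0 <= s], continuous a} /\
  (forall s t : R, 0 <= s -> s < t -> a s < a t).

Definition classKL (R : realType) (beta : R -> R -> R) : Prop :=
  (forall t : R, 0 <= t -> classK (fun s => beta s t)) /\
  (forall s t1 t2 : R, 0 <= s -> 0 <= t1 -> t1 <= t2 -> beta s t2 <= beta s t1) /\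
  (forall s : R, 0 <= s -> beta s t @[t --> +oo] --> 0).

Definition u1 (R : realType) (w Jv tau : R) : R :=
  if 0 < Jv then Num.sqrt (2 * w * Jv) * cos (ln Jv + w * tau) else 0.
Definition u2 (R : realType) (w Jv tau : R) : R :=
  if 0 < Jv then Num.sqrt (2 * w * Jv) * sin (ln Jv + w * tau) else 0.

Definition es_rhs (R : realType) (n r : nat) (b : 'I_r -> 'I_2 -> 'rV[R]_n)
  (omega : 'I_r -> rat) (b0 : 'rV[R]_n -> 'rV[R]_n) (J : 'rV[R]_n -> R)
  (xstar : 'rV[R]_n) (eps : R) (xt : 'rV[R]_n) (tau : R) : 'rV[R]_n :=
  b0 (xt + xstar) + eps^-1 *:
    \sum_(i < r) (u1 (ratr (omega i)) (J (xt + xstar)) tau *: b i ord0 +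
                  u2 (ratr (omega i)) (J (xt + xstar)) tau *: b i ord_max).

(* (x~, tau) is a solution on [0, ts), ts in (0, +oo], from (x0, tau0):
   continuous on [0, ts), differentiable on (0, ts) with the ODE holding there
   (since the right-hand side is continuous, this is equivalent to being C^1 on
   [0, ts) with the one-sided derivative at 0). *)
Definition es_solution (R : realType) (n r : nat) (b : 'I_r -> 'I_2 -> 'rV[R]_n)
  (omega : 'I_r -> rat) (b0 : 'rV[R]_n -> 'rV[R]_n) (J : 'rV[R]_n -> R)
  (xstar : 'rV[R]_n) (eps : R) (x0 : 'rV[R]_n) (tau0 : R) (ts : \bar R)
  (x : R -> 'rV[R]_n) (tau : R -> R) : Prop :=
  (0 < ts)%E /\ x 0 = x0 /\ tau 0 = tau0 /\
  {within [set t : R | 0 <= t /\ (t%:E < ts)%E], continuous x} /\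
  {within [set t : R | 0 <= t /\ (t%:E < ts)%E], continuous tau} /\
  (forall t : R, 0 < t -> (t%:E < ts)%E ->
     derivable x t 1 /\ x^`() t = es_rhs b omega b0 J xstar eps (x t) (tau t) /\
     derivable tau t 1 /\ tau^`() t = eps ^- 2).

Definition es_bounded (R : realType) (n r : nat) (b : 'I_r -> 'I_2 -> 'rV[R]_n)
  (omega : 'I_r -> rat) (b0 : 'rV[R]_n -> 'rV[R]_n) (J : 'rV[R]_n -> R)
  (xstar : 'rV[R]_n) (eps : R) (B : R -> R -> R) : Prop :=
  forall (x0 : 'rV[R]_n) (tau0 : R), 0 <= tau0 ->
    (exists x tau, es_solution b omega b0 J xstar eps x0 tau0 +oo%E x tau) /\
    (forall ts x tau, es_solution b omega b0 J xstar eps x0 tau0 ts x tau ->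
       (exists x' tau', es_solution b omega b0 J xstar eps x0 tau0 +oo%E x' tau' /\
          forall t : R, 0 <= t -> (t%:E < ts)%E -> x' t = x t /\ tau' t = tau t) /\
       (forall t : R, 0 <= t -> (t%:E < ts)%E -> enorm (x t) <= B (enorm x0) t)).

Definition UGUB (R : realType) (n r : nat) (b : 'I_r -> 'I_2 -> 'rV[R]_n)
  (omega : 'I_r -> rat) (b0 : 'rV[R]_n -> 'rV[R]_n) (J : 'rV[R]_n -> R)
  (xstar : 'rV[R]_n) (Delta : R) : Prop :=
  exists beta : R -> R -> R, classKL beta /\
  exists epsS : R, 0 < epsS /\
  forall eps : R, 0 < eps -> eps < epsS ->
    es_bounded b omega b0 J xstar eps (fun s t => beta s t + Delta).

Definition UGPAS (R : realType) (n r : nat) (b : 'I_r -> 'I_2 -> 'rV[R]_n)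
  (omega : 'I_r -> rat) (b0 : 'rV[R]_n -> 'rV[R]_n) (J : 'rV[R]_n -> R)
  (xstar : 'rV[R]_n) : Prop :=
  exists beta : R -> R -> R, classKL beta /\
  forall nu : R, 0 < nu ->
  exists epsS : R, 0 < epsS /\
  forall eps : R, 0 < eps -> eps < epsS ->
    es_bounded b omega b0 J xstar eps (fun s t => beta s t + nu).

(* Main.v *)
Require Import Defs.
From HB Require Import structures.
From mathcomp Require Import all_boot all_order all_algebra.
From mathcomp Require Import all_classical all_reals all_analysis.
From mathcomp Require Import ring lra zify.
Set Implicit Arguments. Unset Strict Implicit. Unset Printing Implicit Defensive.
Import Order.TTheory GRing.Theory Num.Theory numFieldNormedType.Exports.
Local Open Scope ring_scope.
Local Open Scope classical_set_scope.

(* Integrating the oscillating inputs twice in the fast phase produces a change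
   of variables z = x + O(eps) (the map [zmap]) under which the system becomes
   z' = b0(x) - sum_ij b_ij (b_ij . grad J) + (skew terms) + O(eps |grad J|).
   The skew terms, coming from the products of the sine and cosine inputs of the
   same frequency, are orthogonal to grad J, so that J(z) decays at the rate
   (gamma - kappa3)/2 |grad J|^2 as long as |x - x*| >= r0, where J is bounded
   below by a positive constant and sqrt J and |grad J| are comparable.
   Correcting x rather than J keeps the computation within C^2: the second
   derivatives of J enter, but are not differentiated.  After the last time at
   which |x - x*| = r0 the decay keeps the solution in a ball which shrinks with
   r0, and before it the decay gives a KL bound independent of r0; if J* >= 0
   then r0 is arbitrary.

   If J* < 0 the right-hand side is not Lipschitz on {J = 0} and solutions need
   not be unique.  Existence and continuation therefore rest on Peano's theorem,
   obtained from Euler polygons by taking a limit along an ultrafilter. *)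

(** * Row vectors *)

(** One threshold on [eps] has to serve all initial conditions, although the region outside the ball
    is unbounded. Homogeneity makes this possible: there the inputs, of size sqrt J, are of order
    |grad J|, so every error term is at most a constant times eps |grad J|^2 and is absorbed by the
    margin [gamma - kappa3] everywhere at once. The comparison rests on |grad J|^2 <= C1 (J - J
    xstar) and J - J xstar <= C1 |x - xstar|^2, both from the bounded Hessian, and on |x - xstar| <=
    |grad J| / alpha(r0) outside the ball of radius r0.

    The decay has no fixed rate, and the KL bound is not obtained by solving a comparison equation.
    On a stretch outside the ball that ends at time t, J(z) decreases, so the earlier distances are
    bounded below in terms of the final one. The decay was therefore at least a rate determined by
    the final distance, over the whole stretch. This is an inequality between the final distance,
    the elapsed time and the initial distance, which is then inverted. *)

Section RowVectors.
Variables (R : realType) (n : nat).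
Implicit Types (u v : 'rV[R]_n) (e : R).

(** The norm on row vectors is the maximum norm; it carries the topology, while the estimates are
    Euclidean. The lemmas of this section pass between the two. *)
Lemma normr_coord v i : `|v 0 i| <= `|v|.
Proof.
rewrite [leRHS]/Num.Def.normr/= mx_normrE.
exact: (le_bigmax _ (fun ij : 'I_1 * 'I_n => `|v ij.1 ij.2|) (0, i)).
Qed.

Lemma normr_row_le v e : 0 <= e -> (forall i, `|v 0 i| <= e) -> `|v| <= e.
Proof.
move=> e0 ve; rewrite [leLHS]/Num.Def.normr/= mx_normrE bigmax_le//= => -[i j] _.
by rewrite ord1; exact: ve.
Qed.

Lemma enorm_ge0 v : 0 <= enorm v.
Proof. exact: sqrtr_ge0. Qed.

Lemma sqr_enorm v : enorm v ^+ 2 = \sum_i v 0 i ^+ 2.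
Proof. by rewrite sqr_sqrtr// sumr_ge0// => i _; exact: sqr_ge0. Qed.

Lemma coord_enorm v i : `|v 0 i| <= enorm v.
Proof.
rewrite -(ler_pXn2r (n := 2))// ?nnegrE ?enorm_ge0// real_normK ?num_real//.
by rewrite sqr_enorm (bigD1 i)//= lerDl sumr_ge0// => j _; exact: sqr_ge0.
Qed.

Lemma normr_le_enorm v : `|v| <= enorm v.
Proof. by apply: normr_row_le; [exact: enorm_ge0 | exact: coord_enorm]. Qed.

Lemma enorm_le_sum v : enorm v <= \sum_i `|v 0 i|.
Proof.
have s0 (P : pred 'I_n) : 0 <= \sum_(i | P i) `|v 0 i| by exact: sumr_ge0.
rewrite -(ler_pXn2r (n := 2))// ?nnegrE ?enorm_ge0// sqr_enorm.
rewrite expr2 mulr_suml ler_sum// => i _.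
rewrite -[leLHS]real_normK ?num_real// expr2 ler_wpM2l//.
by rewrite (bigD1 i)//= lerDl.
Qed.

Lemma sum_coord_le v e : (forall i, `|v 0 i| <= e) -> \sum_i `|v 0 i| <= n%:R * e.
Proof.
move=> ve; apply: le_trans (ler_sum _ (fun i _ => ve i)) _.
by rewrite sumr_const card_ord mulr_natl.
Qed.

Lemma enorm_le_normr v : enorm v <= n%:R * `|v|.
Proof. exact: le_trans (enorm_le_sum v) (sum_coord_le (normr_coord v)). Qed.

Lemma dotvv v : dotv v v = enorm v ^+ 2.
Proof. by rewrite sqr_enorm; apply: eq_bigr => i _; rewrite expr2. Qed.

Lemma enorm_eq0_coord v i : enorm v = 0 -> v 0 i = 0.
Proof. by move=> v0; have := coord_enorm v i; rewrite v0 normr_le0 => /eqP. Qed.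

Lemma dotv_le u v : dotv u v <= enorm u * enorm v.
Proof.
have [u0|u0] := eqVneq (enorm u) 0.
  by rewrite u0 mul0r /dotv big1// => i _; rewrite enorm_eq0_coord// mul0r.
have [v0|v0] := eqVneq (enorm v) 0.
  by rewrite v0 mulr0 /dotv big1// => i _; rewrite (enorm_eq0_coord _ v0) mulr0.
have p : 0 < enorm u * enorm v by rewrite mulr_gt0// lt_def ?u0 ?v0 enorm_ge0.
(* Expanding | |v| u - |u| v |^2 >= 0 gives Cauchy-Schwarz multiplied by the positive factor 2 |u|
   |v|. *)
have : 0 <= \sum_i (enorm v * u 0 i - enorm u * v 0 i) ^+ 2.
  by apply: sumr_ge0 => i _; exact: sqr_ge0.
have -> : \sum_i (enorm v * u 0 i - enorm u * v 0 i) ^+ 2 =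
  enorm v ^+ 2 * \sum_i u 0 i ^+ 2 - 2 * (enorm u * enorm v) * dotv u v
  + enorm u ^+ 2 * \sum_i v 0 i ^+ 2.
  rewrite /dotv !mulr_sumr -sumrB -big_split/=; apply: eq_bigr => i _; ring.
rewrite -!sqr_enorm => H; rewrite -(ler_pM2l p); nra.
Qed.
End RowVectors.

(** * Peano existence theorem *)

Section Derivative.
Variables (R : realType) (V : normedModType R).
Implicit Types (X : R -> V) (t : R).

Lemma is_derive_eps X t v :
  (forall e : R, 0 < e -> exists2 d, 0 < d & forall u, `|u - t| < d ->
     `|X u - X t - (u - t) *: v| <= e * `|u - t|) ->
  is_derive t 1 X v.
Proof.
move=> H.
suff Hc : h^-1 *: ((X \o shift t) h%:A - X t) @[h --> 0^'] --> v.
  have E : 'D_1 X t = v by exact: cvg_lim.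
  by rewrite -E in Hc *; constructor => //; apply: cvgP Hc.
apply/cvgrPdist_le => e e0; have [d d0 Hd] := H e e0.
near=> h.
have h0 : h != 0 by near: h; exact: nbhs_dnbhs_neq.
have hd : `|h| < d by near: h; exact: dnbhs0_lt.
have := Hd (h + t); rewrite addrK => /(_ hd) Hh.
rewrite /= [_%:A]mulr1 -normrN opprB.
have -> : h^-1 *: (X (h + t) - X t) - v =
    h^-1 *: (X (h + t) - X t - h *: v).
  by rewrite [in RHS]scalerBr scalerA mulVf// scale1r.
by rewrite normrZ normfV ler_pdivrMl ?normr_gt0// mulrC.
Unshelve. all: by end_near. Qed.

End Derivative.

Section Peano.
Variables (R : realType) (n : nat).
Local Notation V := 'rV[R]_n.
Variables (F : R -> V -> V) (K : R) (x0 : V).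
Hypothesis K0 : 0 <= K.
Hypothesis Fgrowth : forall t x, `|F t x| <= K * (1 + `|x|).
Hypothesis Fcont : continuous (fun p : R * V => F p.1 p.2).

Let step (k : nat) : R := k.+1%:R^-1.

Fixpoint euler (k j : nat) : V :=
  if j is j'.+1 then euler k j' + step k *: F (j'%:R * step k) (euler k j')
  else x0.

Let step_gt0 k : 0 < step k.
Proof. by rewrite invr_gt0. Qed.

(** Discrete Gronwall: a step multiplies the bound for [1 + |x|] by [1 + step k * K], which is at
    most [expR (step k * K)]. *)
Lemma euler_growth k j : 1 + `|euler k j| <= expR (K * (j%:R * step k)) * (1 + `|x0|).
Proof.
elim: j => [|j IH]; first by rewrite mul0r mulr0 expR0 mul1r.
have h0 := step_gt0 k.
apply: (@le_trans _ _ ((1 + step k * K) * (1 + `|euler k j|))).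
  rewrite [leRHS]mulrDl mul1r -addrA lerD2l/=.
  apply: le_trans (ler_normD _ _) _; rewrite lerD2l normrZ gtr0_norm// -mulrA.
  by rewrite ler_wpM2l ?Fgrowth// ltW.
have -> : K * (j.+1%:R * step k) = step k * K + K * (j%:R * step k).
  by rewrite -[j.+1%:R]natr1; ring.
rewrite expRD -mulrA ler_pM ?expR_ge1Dx// addr_ge0// mulr_ge0// ltW//.
Qed.

(** With [v = 0] this bounds the displacement between nodes; with [v = F t (X t)] it yields the
    derivative of the limit. *)
Lemma euler_increment k v e l m : (l <= m)%N ->
  (forall j, (l <= j < m)%N -> `|F (j%:R * step k) (euler k j) - v| <= e) ->
  `|euler k m - euler k l - ((m - l)%:R * step k) *: v| <= (m - l)%:R * step k * e.
Proof.
move=> /subnKC <-; rewrite addKn; elim: (m - l)%N => [|d IH] H.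
  by rewrite addn0 subrr !mul0r scale0r subr0 normr0.
have h0 := step_gt0 k.
have IH' := IH (fun j jd => H j ltac:(lia)).
have Hd := H (l + d)%N ltac:(lia).
rewrite addnS /= -[d.+1%:R]natr1 mulrDl mulrDl mul1r.
set a := euler k (l + d) in IH' Hd *; set f := F _ _ in Hd *.
have -> : a + step k *: f - euler k l - (d%:R * step k + step k) *: v =
  (a - euler k l - (d%:R * step k) *: v) + step k *: (f - v).
  rewrite scalerDl scalerBr; rewrite opprD.
  by rewrite -!addrA; congr (_ + _); rewrite addrCA; congr (_ + _);
     rewrite addrCA.
apply: le_trans (ler_normD _ _) _; apply: lerD => //.
by rewrite normrZ gtr0_norm// ler_wpM2l// ltW.
Qed.

Let idx (k : nat) (t : R) : nat := Num.trunc (t * k.+1%:R).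

Lemma idx_itv k t : 0 <= t -> (idx k t)%:R * step k <= t < (idx k t)%:R * step k + step k.
Proof.
move=> t0; have := @truncn_itv R (t * k.+1%:R).
rewrite mulr_ge0// => /(_ isT) /andP[H1 H2].
rewrite /step ler_pdivrMr// H1/=.
by rewrite -[X in _ < _ + X]mul1r -mulrDl ltr_pdivlMr// natr1.
Qed.

Lemma le_idx k s t : s <= t -> (idx k s <= idx k t)%N.
Proof. by move=> st; apply: le_truncn; rewrite ler_wpM2r. Qed.

Lemma euler_itv_bound T k j : j%:R * step k <= T ->
  `|euler k j| <= expR (K * T) * (1 + `|x0|).
Proof.
move=> jT; apply: (@le_trans _ _ (1 + `|euler k j|)); first by rewrite lerDr.
apply: le_trans (euler_growth k j) _.
rewrite ler_wpM2r ?addr_ge0// ler_expR ler_wpM2l//.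
Qed.

(** An ultrafilter converges in every compact set, so a single one serves all times and no
    subsequences are extracted. Convergence is only pointwise in [t]; continuity of the limit is
    recovered from [euler_limit_approx]. *)
Lemma euler_limit : exists (U : set_system nat) (X : R -> V),
  [/\ ProperFilter U, \oo `<=` U &
   forall t : R, 0 <= t -> euler k (idx k t) @[k --> U] --> X t].
Proof.
have [U [UU oU]] := @ultraFilterLemma nat \oo _.
have PU : ProperFilter U by exact: ultra_proper.
suff H (t : R) : exists y : V, 0 <= t -> euler k (idx k t) @[k --> U] --> y.
  by have [X HX] := choice H; exists U, X.
have [t0|t0] := leP 0 t; last by exists 0; move=> ?; lra.
set B := expR (K * t) * (1 + `|x0|).
pose A := closed_ball_ (fun x : V => `|x|) 0 B.
have cA : compact A.
  apply: bounded_closed_compact; last first.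
    by apply: closed_closed_ball_.
  exists B; split; first exact: num_real.
  by move=> M BM x; rewrite /A/= /closed_ball_/= sub0r normrN => /le_trans; apply; exact: ltW.
have FA : U [set k | A (euler k (idx k t))].
  apply: filterE => k; rewrite /A/= /closed_ball_/= sub0r normrN.
  by apply: euler_itv_bound; have /andP[] := idx_itv k t0.
have [p [_ pc]] := cA (euler k (idx k t) @[k --> U]) _ FA.
exists p => _ W pW; have [//|nW] := in_ultra_setVsetC (fun k => W (euler k (idx k t))) UU.
by have [q []] := pc (~` W) W nW pW.
Qed.


Lemma Fcont_eps (t : R) x (e : R) : 0 < e -> exists2 d : R, 0 < d &
  forall (s : R) (y : V), `|s - t| < d -> `|y - x| < d -> `|F s y - F t x| <= e.
Proof.
move=> e0; have /cvgrPdist_le/(_ e e0) := @Fcont (t, x).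
move=> /nbhs_ballP[d /= d0 H]; exists d => // s y sd yd.
rewrite distrC; apply: (H (s, y)); split=> /=; first by rewrite /ball/= distrC.
by rewrite -ball_normE /ball_/= distrC.
Qed.

(** Near [t] the nodes stay where [F] is within [e] of [F t (X t)], and the resulting estimate on
    polygons passes to the limit. The cases [s = t] and [u = t] give the two one-sided estimates, of
    which only the first exists at [t = 0]. *)
Lemma euler_limit_approx (U : set_system nat) (X : R -> V) :
  ProperFilter U -> \oo `<=` U ->
  (forall t : R, 0 <= t -> euler k (idx k t) @[k --> U] --> X t) ->
  forall t e : R, 0 <= t -> 0 < e -> exists2 d : R, 0 < d &
    forall s u : R, 0 <= s -> s <= u -> t - d < s -> u < t + d ->
    s <= t <= u ->
     `|X u - X s - (u - s) *: F t (X t)| <= e * (u - s).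
Proof.
move=> PU oU XU t e t0 e0.
have [d1 d10 Fd1] := Fcont_eps t (X t) e0.
pose M := K * (1 + expR (K * (t + 1)) * (1 + `|x0|)).
have M0 : 0 <= M by rewrite mulr_ge0// addr_ge0// mulr_ge0// ?addr_ge0// expR_ge0.
have M1 : 0 < M + 1 by lra.
(* [2 * d * M <= d1 / 2] keeps the nodes near the one of [t], [d <= d1 / 4] keeps their times within
   [d1] of [t], and [d <= 1 / 4] keeps them before [t + 1], where [M] is valid. [M + 1] is there
   because [M] may vanish. *)
pose d := Num.min (d1 / (2 * (2 * (M + 1)))) (Num.min (d1 / 4) (1 / 4)).
have [dM dd1 d1' d0] : [/\ d * (2 * (M + 1)) <= d1 / 2, d <= d1 / 4, d <= 1 / 4 & 0 < d].
  split; rewrite /d ?ge_min ?lexx ?orbT//.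
  - rewrite -ler_pdivlMr ?mulr_gt0// -mulrA -invfM ge_min; apply/orP; left.
    exact: lexx.
  - by rewrite !lt_min !divr_gt0// ?mulr_gt0.
exists d => // s u s0 su sd ud /andP[st tu].
set v := F t (X t).
apply/ler_addgt0Pr => a a0.
(* The slack [a] pays for two endpoint errors of [b / 2], and for rounding [u - s] to nodes, which
   costs at most [b / 2] times [|v|] and times [e]. *)
pose b := a / (2 + `|v| + e).
have c0 : 0 < 2 + `|v| + e by rewrite addr_gt0// ltr_wpDr.
have b0 : 0 < b by rewrite divr_gt0.
have b20 : 0 < b / 2 by lra.
have d120 : 0 < d1 / 2 by lra.
have [k [ku ks kt kb kd]] : exists k, [/\ `|X u - euler k (idx k u)| < b / 2,
    `|X s - euler k (idx k s)| < b / 2, `|X t - euler k (idx k t)| < d1 / 2,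
    step k < b / 2 & step k < d].
  have near_lim (r c : R) : 0 <= r -> 0 < c -> U [set k | `|X r - euler k (idx k r)| < c].
    by move=> r0 c0'; have /cvgrPdist_lt/(_ c c0') := XU r r0; exact.
  have near_step (c : R) : 0 < c -> U [set k | step k < c].
    by move=> c0'; apply: oU; exact: near_infty_natSinv_lt (PosNum c0').
  have H := filterI (near_lim u (b / 2) (le_trans s0 su) b20)
    (filterI (near_lim s (b / 2) s0 b20)
    (filterI (near_lim t (d1 / 2) t0 d120)
    (filterI (near_step (b / 2) b20) (near_step d d0)))).
  by have [k [? [? [? [? ?]]]]] := @filter_ex _ U PU _ (H _ _ _ _); exists k.
have h0 := step_gt0 k.
have /andP[is1 is2] := idx_itv k s0.
have /andP[it1 it2] := idx_itv k t0.
have /andP[iu1 iu2] := idx_itv k (le_trans s0 su).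
have lst : (idx k s <= idx k t)%N by exact: le_idx.
have ltu : (idx k t <= idx k u)%N by exact: le_idx.
have growth j : (j <= idx k u)%N -> `|F (j%:R * step k) (euler k j) - 0| <= M.
  move=> ju; rewrite subr0; apply: le_trans (Fgrowth _ _) _.
  rewrite ler_wpM2l// lerD2l euler_itv_bound//.
  have : j%:R * step k <= (idx k u)%:R * step k by rewrite ler_wpM2r ?ler_nat// ltW.
  lra.
have close j : (idx k s <= j < idx k u)%N -> `|F (j%:R * step k) (euler k j) - v| <= e.
  move=> /andP[sj ju].
  have js : (idx k s)%:R * step k <= j%:R * step k by rewrite ler_wpM2r ?ler_nat// ltW.
  have ju' : j%:R * step k <= (idx k u)%:R * step k.
    by rewrite ler_wpM2r ?ler_nat ?(ltnW ju)// ltW.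
  apply: Fd1; first by rewrite ltr_norml; apply/andP; split; lra.
  have Hj : `|euler k j - euler k (idx k t)| <= 2 * d * M.
    have [jt|tj] := leqP j (idx k t).
      have := @euler_increment k 0 M j (idx k t) jt.
      rewrite scaler0 subr0 -normrN opprB => /(_ _)/le_trans; apply.
        by move=> i /andP[_ it]; apply: growth; exact: leq_trans (ltnW it) ltu.
      rewrite ler_wpM2r// natrB// mulrBl.
      have : (idx k t)%:R * step k <= t by [].
      lra.
    have := @euler_increment k 0 M (idx k t) j (ltnW tj).
    rewrite scaler0 subr0 => /(_ _)/le_trans; apply.
      by move=> i /andP[_ it]; apply: growth; exact: ltnW (leq_trans it (ltnW ju)).
    rewrite ler_wpM2r// natrB 1?ltnW// mulrBl; lra.
  rewrite (_ : euler k j - X t = (euler k j - euler k (idx k t)) + (euler k (idx k t) - X t)); last first.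
    by rewrite addrA subrK.
  apply: le_lt_trans (ler_normD _ _) _.
  rewrite distrC in kt; have : 2 * d * M <= d1 / 2 by nra.
  lra.
have E := euler_increment (leq_trans lst ltu) close.
rewrite natrB in E; last exact: leq_trans lst ltu.
rewrite mulrBl in E.
set w := (idx k u)%:R * step k - (idx k s)%:R * step k in E.
have wus : `|w - (u - s)| <= step k by rewrite ler_norml /w; apply/andP; split; lra.
have -> : X u - X s - (u - s) *: v =
  (euler k (idx k u) - euler k (idx k s) - w *: v) + (X u - euler k (idx k u))
   - (X s - euler k (idx k s)) + (w - (u - s)) *: v.
  rewrite scalerBl.
  move: (euler k (idx k u)) (euler k (idx k s)) => p q.
  apply/rowP => i; rewrite !mxE; ring.
have T1 : `|(w - (u - s)) *: v| <= b / 2 * `|v|.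
  rewrite normrZ ler_wpM2r//; lra.
have w1 : w <= (u - s) + b / 2 by move: wus; rewrite ler_norml => /andP[]; lra.
have T2 : w * e <= (u - s) * e + b / 2 * e by nra.
have ab : a = b * (2 + `|v| + e) by rewrite /b divfK// gt_eqF.
apply: le_trans (ler_normD _ _) _.
apply: le_trans (lerD (ler_normB _ _) T1) _.
apply: le_trans (lerD (lerD (ler_normD _ _) (lexx _)) (lexx _)) _.
have ve0 : 0 <= `|v| by [].
nra.
Qed.

Theorem peano : exists X : R -> V, [/\ X 0 = x0, continuous X &
  forall t : R, 0 < t -> is_derive t 1 X (F t (X t))].
Proof.
have [U [Z [PU oU ZU]]] := euler_limit.
have A := euler_limit_approx PU oU ZU.
have Z0 : Z 0 = x0.
  apply: (@cvg_unique _ (@norm_hausdorff _ _) _ _ _ _ (ZU 0 (lexx _))).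
  by rewrite /idx (_ : (fun k => _) = cst x0); [exact: cvg_cst | apply/funext => k; rewrite mul0r truncn0].
have A1 (t e : R) : 0 <= t -> 0 < e -> exists2 d : R, 0 < d &
    forall u : R, 0 <= u -> `|u - t| < d -> `|Z u - Z t - (u - t) *: F t (Z t)| <= e * `|u - t|.
  move=> t0 e0; have [d d0 Hd] := A t e t0 e0; exists d => // u u0.
  rewrite ltr_norml => /andP[u1 u2].
  have [ut|tu] := leP u t.
    rewrite (_ : Z u - _ - _ = - (Z t - Z u - (t - u) *: F t (Z t))); last first.
      by rewrite opprB -(opprB u t) scaleNr (opprB (Z t)) addrC.
    rewrite normrN (distrC u t) (ger0_norm (x := t - u)) ?subr_ge0//.
    have := Hd u t u0 ut; rewrite ut lexx; apply => //; lra.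
  rewrite gtr0_norm ?subr_gt0//.
  have := Hd t u t0 (ltW tu); rewrite (ltW tu) lexx; apply => //; lra.
(* Freezing the curve at negative times makes it continuous on the whole line. *)
exists (fun t => Z (Num.max t 0)); split.
- by rewrite maxxx.
- move=> t; apply/cvgrPdist_le => e e0.
  have t0 : 0 <= Num.max t 0 by rewrite le_max lexx orbT.
  have [d d0 Hd] := A1 _ 1 t0 ltr01.
  set v := F _ _ in Hd.
  have v1 : 0 < 1 + `|v| by rewrite ltr_wpDr.
  have m0 : 0 < Num.min d (e / (1 + `|v|)) by rewrite lt_min d0 divr_gt0.
  near=> s.
  have s0 : 0 <= Num.max s 0 by rewrite le_max lexx orbT.
  have st : `|Num.max s 0 - Num.max t 0| <= `|s - t|.
    rewrite /Num.max; case: ltrP => ?; case: ltrP => ?; rewrite ?subrr ?normr0//.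
    - by rewrite sub0r normrN ger0_norm// ltr0_norm; lra.
    - by rewrite subr0 ger0_norm// ger0_norm; lra.
  have sd : `|s - t| < Num.min d (e / (1 + `|v|)).
    rewrite distrC; near: s; exact: (nbhsx_ballx t _ m0).
  move: sd; rewrite lt_min => /andP[sd se].
  have := Hd _ s0 (le_lt_trans st sd); rewrite mul1r => H.
  rewrite distrC -[X in `|X|](subrK ((Num.max s 0 - Num.max t 0) *: v)).
  apply: le_trans (ler_normD _ _) _; rewrite normrZ.
  move: se; rewrite ltr_pdivlMr// => se.
  have v0 : 0 <= `|v| by [].
  nra.
- move=> t t0; rewrite (max_idPl (ltW t0)).
  apply: is_derive_eps => e e0; have [d d0 Hd] := A1 t e (ltW t0) e0.
  exists (Num.min d t); first by rewrite lt_min d0.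
  move=> u; rewrite lt_min => /andP[ud ut].
  have u0 : 0 <= u by move: ut; rewrite ltr_norml => /andP[]; lra.
  by rewrite (max_idPl (ltW t0)) (max_idPl u0); exact: Hd.
Unshelve. all: by end_near. Qed.

End Peano.

(** * Mean values and chain rule along curves *)

Section MeanValue.
Variable R : realType.

Lemma mvt_unordered (g dg : R -> R) (a b : R) : (forall s : R, is_derive s 1 g (dg s)) ->
  exists2 c, `|c - a| <= `|b - a| & g b - g a = dg c * (b - a).
Proof.
move=> Hg.
have cg (x y : R) : {within `[x, y], continuous g}.
  apply: continuous_subspaceT => s.
  by apply/differentiable_continuous/derivable1_diffP; case: (Hg s).
have [ab|ba] := leP a b.
  have [c + ->] := @MVT_segment R g dg a b ab (fun s _ => Hg s) (cg a b).
  rewrite in_itv/= => /andP[ac cb]; exists c => //.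
  by rewrite !ger0_norm ?subr_ge0//; lra.
have [c + E] := @MVT_segment R g dg b a (ltW ba) (fun s _ => Hg s) (cg b a).
rewrite in_itv/= => /andP[bc ca]; exists c; last by rewrite -opprB E; ring.
have ba' := ltW ba.
by rewrite !ler0_norm ?subr_le0//; lra.
Qed.

Variable n : nat.
Local Notation V := 'rV[R]_n.
Implicit Types (f : V -> R) (x y : V).

Lemma is_derive_line f (p v : V) (s l : R) : is_derive (p + s *: v) v f l ->
  is_derive s 1 (fun u : R => f (p + u *: v)) l.
Proof.
have E : (fun h : R => h^-1 *: (((fun u : R => f (p + u *: v)) \o shift s) (h *: (1 : R))
     - f (p + s *: v))) =
   (fun h : R => h^-1 *: ((f \o shift (p + s *: v)) (h *: v) - f (p + s *: v))).
  apply/funext => h /=; congr (_ *: (f _ - _)).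
  by rewrite [_ *: 1]mulr1 scalerDl addrCA.
by case=> d1 d2; constructor; [rewrite /derivable E|rewrite /derive E].
Qed.

(** Coordinates are changed from [x] to [y] one at a time, so existence of the partial derivatives
    suffices. The coordinatewise bound on [xi] is what makes continuity or Lipschitz bounds of the
    partials applicable there. *)
Lemma partial_mvt f x y : (forall i z, derivable f z (evec R i)) ->
  exists2 xi : 'I_n -> V,
    (forall j k, `|xi j 0 k - x 0 k| <= `|y 0 k - x 0 k|) &
    f y - f x = \sum_j partial j f (xi j) * (y 0 j - x 0 j).
Proof.
move=> df.
pose p (k : nat) : V := \row_i (if (i < k)%N then y 0 i else x 0 i).
have p0 : p 0%N = x by apply/rowP => i; rewrite mxE.
have pn : p n = y by apply/rowP => i; rewrite mxE ltn_ord.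
have pS (j : 'I_n) : p j.+1 = p j + (y 0 j - x 0 j) *: evec R j.
  apply/rowP => i; rewrite !mxE eqxx/= ltnS leq_eqVlt val_eqE.
  have [->|ij] := eqVneq i j; first by rewrite ltnn mulr1 subrKC.
  by rewrite mulr0 addr0.
have H (j : 'I_n) : exists z : V, (forall k, `|z 0 k - x 0 k| <= `|y 0 k - x 0 k|) /\
    f (p j.+1) - f (p j) = partial j f z * (y 0 j - x 0 j).
  have [s] := @mvt_unordered (fun u : R => f (p j + u *: evec R j))
    (fun u => partial j f (p j + u *: evec R j)) 0 (y 0 j - x 0 j)
    (fun s => is_derive_line (derivableP (df j _))).
  rewrite !subr0 scale0r addr0 -pS => sd E; exists (p j + s *: evec R j).
  split=> // k; rewrite !mxE eqxx/=.
  have [->|kj] := eqVneq k j; first by rewrite ltnn mulr1 addrAC subrr add0r.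
  by rewrite mulr0 addr0; case: ifP => // _; rewrite subrr normr0.
have [xi Hxi] := choice H; exists xi; first by move=> j k; have [] := Hxi j.
rewrite -[in LHS]pn -[in LHS]p0 -(telescope_sumr (fun k => f (p k)) (leq0n n)).
by rewrite big_mkord; apply: eq_bigr => j _; have [] := Hxi j.
Qed.

(** [C2] speaks of partial derivatives only, hence a chain rule built on [partial_mvt]: in
    Caratheodory's form the slope is a sum of partials at points squeezed towards [x t]. *)
Lemma is_derive_comp_curve f (x : R -> V) (t : R) (v : 'I_n -> R) :
  (forall i z, derivable f z (evec R i)) ->
  (forall i, {for x t, continuous (partial i f)}) ->
  (forall i, is_derive t 1 (fun u => x u 0 i) (v i)) ->
  is_derive t 1 (fun u => f (x u)) (\sum_i partial i f (x t) * v i).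
Proof.
move=> df cf dx.
have xc (e : R) : 0 < e -> \forall u \near t, forall k, `|x u 0 k - x t 0 k| < e.
  move=> e0.
  apply: (@filter_forall R 'I_n (fun k u => `|x u 0 k - x t 0 k| < e) (nbhs t) _) => k.
  have /derivable1_diffP/differentiable_continuous/cvgrPdist_lt/(_ e e0) :
    derivable (fun u => x u 0 k) t 1 by case: (dx k).
  by apply: filterS => u; rewrite distrC.
have [g Hg] := choice (fun i => (is_derive1_caratheodory _ _ _).1 (dx i)).
have /choice[xi Hxi] : forall u, exists z : 'I_n -> V,
    (forall j k, `|z j 0 k - x t 0 k| <= `|x u 0 k - x t 0 k|) /\
    f (x u) - f (x t) = \sum_j partial j f (z j) * (x u 0 j - x t 0 j).
  by move=> u; have [z z1 z2] := partial_mvt (x t) (x u) df; exists z.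
apply/is_derive1_caratheodory.
have xit j : xi t j = x t.
  apply/rowP => k; have := (Hxi t).1 j k.
  by rewrite subrr normr0 normr_le0 subr_eq0 => /eqP.
exists (fun u => \sum_j partial j f (xi u j) * g j u); split.
- move=> u; rewrite (Hxi u).2 mulr_suml; apply: eq_bigr => j _.
  by have [-> _ _] := Hg j; rewrite mulrA.
- apply: (cvg_big (op := +%R)) => [|j _]; first exact: add_continuous.
  apply: cvgM; last by have [_ + _] := Hg j; exact.
  rewrite xit; apply: (@cvg_comp _ _ _ (fun u => xi u j) (partial j f) _ (nbhs (x t)));
    last exact: cf.
  apply/cvgrPdist_le => e e0; near=> u.
  apply: normr_row_le => [|k]; first exact: ltW.
  rewrite !mxE distrC; apply: le_trans ((Hxi u).1 j k) _; apply/ltW.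
  by move: k; near: u; exact: xc.
- by apply: eq_bigr => j _; rewrite xit; have [_ _ ->] := Hg j.
Unshelve. all: by end_near. Qed.

End MeanValue.

(** * Functions with bounded Hessian *)

Lemma normr_le_sqrt_sum2 (R : realType) (n : nat) (M : 'I_n -> 'I_n -> R) i j :
  `|M i j| <= Num.sqrt (\sum_(i < n) \sum_(j < n) M i j ^+ 2).
Proof.
rewrite -sqrtr_sqr ler_wsqrtr// (bigD1 i)//= (bigD1 j)//= -addrA lerDl addr_ge0//.
  by rewrite sumr_ge0// => l _; exact: sqr_ge0.
by rewrite sumr_ge0// => k _; rewrite sumr_ge0// => l _; exact: sqr_ge0.
Qed.

Section BoundedHessian.
Variables (R : realType) (n : nat) (J : 'rV[R]_n -> R) (L : R).
Local Notation V := 'rV[R]_n.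
Hypothesis JC2 : C2 J.
Hypothesis L_gt0 : 0 < L.
Hypothesis JL : forall x, hess_norm J x <= L.
Implicit Types x y : V.

Lemma second_partial_le i j x : `|partial j (partial i J) x| <= L.
Proof.
exact: le_trans (normr_le_sqrt_sum2 (fun i j => partial j (partial i J) x) i j) (JL x).
Qed.

Lemma partial_lipschitz i x y :
  `|partial i J y - partial i J x| <= L * \sum_k `|y 0 k - x 0 k|.
Proof.
have [_ [d2 _]] := JC2.
have [xi _ ->] := partial_mvt x y (d2 i).
apply: le_trans (ler_norm_sum _ _ _) _; rewrite mulr_sumr ler_sum// => j _.
by rewrite normrM ler_wpM2r// second_partial_le.
Qed.

Lemma taylor2 x y :
  `|J y - J x - dotv (grad J x) (y - x)| <= L * (\sum_k `|y 0 k - x 0 k|) ^+ 2.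
Proof.
have [d1 _] := JC2.
have [xi Hxi ->] := partial_mvt x y d1.
rewrite /dotv -sumrB; apply: le_trans (ler_norm_sum _ _ _) _.
rewrite expr2 mulrA mulr_sumr ler_sum// => j _.
rewrite !mxE -mulrBl normrM ler_wpM2r//.
apply: le_trans (partial_lipschitz _ _ _) _; rewrite ler_wpM2l ?(ltW L_gt0)//.
by rewrite ler_sum// => k _; exact: Hxi.
Qed.

Lemma partial_continuous i : continuous (partial i J).
Proof.
move=> x; apply/(@cvgrPdist_le _ _ _ (nbhs x)) => e e0.
have c0 : 0 < L * n%:R + 1 by rewrite ltr_wpDl// mulr_ge0// ltW.
have m0 : 0 < e / (L * n%:R + 1) by rewrite divr_gt0.
near=> y.
have xy : `|x - y| < e / (L * n%:R + 1) by near: y; have := nbhsx_ballx x _ m0; rewrite -ball_normE.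
apply: le_trans (partial_lipschitz _ _ _) _.
apply: (@le_trans _ _ (L * (n%:R * `|x - y|))).
  rewrite ler_wpM2l ?(ltW L_gt0)//.
  rewrite (eq_bigr (fun k => `|(x - y) 0 k|)); last by move=> k _; rewrite !mxE.
  exact: (sum_coord_le (normr_coord (x - y))).
move: xy; rewrite ltr_pdivlMr// => xy.
have : 0 <= `|x - y| by [].
rewrite mulrA; nra.
Unshelve. all: by end_near. Qed.

Lemma sum_sub_le_enorm x y : \sum_k `|y 0 k - x 0 k| <= n%:R * enorm (y - x).
Proof.
rewrite (eq_bigr (fun k => `|(y - x) 0 k|)); last by move=> k _; rewrite !mxE.
exact: (sum_coord_le (coord_enorm (y - x))).
Qed.

Lemma is_derive_J_curve (x : R -> V) (t : R) (v : 'I_n -> R) :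
  (forall i, is_derive t 1 (fun u => x u 0 i) (v i)) ->
  is_derive t 1 (fun u => J (x u)) (\sum_i grad J (x t) 0 i * v i).
Proof.
move=> dx; have [d1 _] := JC2.
rewrite (eq_bigr (fun i => partial i J (x t) * v i)); last by move=> i _; rewrite mxE.
by apply: is_derive_comp_curve => // i; exact: partial_continuous.
Qed.

Lemma is_derive_partial_curve i (x : R -> V) (t : R) (v : 'I_n -> R) :
  (forall k, is_derive t 1 (fun u => x u 0 k) (v k)) ->
  is_derive t 1 (fun u => partial i J (x u))
    (\sum_k partial k (partial i J) (x t) * v k).
Proof.
move=> dx; have [_ [d2 c2]] := JC2.
by apply: is_derive_comp_curve => // k; exact: c2.
Qed.

Variable xstar : V.
Hypothesis Jmin : forall x, J xstar <= J x.
Hypothesis grad0 : grad J xstar = 0.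

(** A gradient step of length [s = 1 / (2 L m^2)] lowers J by at least [s / 2] times |grad J|^2, and
    it cannot go below the minimum. The dimension enters as [m = n + 1], which is never zero. *)
Lemma sqr_grad_le x : enorm (grad J x) ^+ 2 <= 4 * L * n.+1%:R ^+ 2 * (J x - J xstar).
Proof.
set m : R := n.+1%:R; have m0 : 0 < m by rewrite ltr0n.
have nm : n%:R <= m by rewrite ler_nat.
set g := grad J x; set c := 4 * L * m ^+ 2.
have c0 : 0 < c by rewrite !mulr_gt0// exprn_gt0.
pose s := 2 / c.
have s0 : 0 < s by rewrite divr_gt0.
pose y := x - s *: g.
have := taylor2 x y.
have -> : y - x = - (s *: g) by rewrite /y addrAC subrr add0r.
have -> : dotv (grad J x) (- (s *: g)) = - (s * enorm g ^+ 2).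
  rewrite sqr_enorm mulr_sumr -sumrN; apply: eq_bigr => i _.
  by rewrite !mxE; ring.
rewrite opprK ler_norml => /andP[_].
have S : \sum_k `|y 0 k - x 0 k| <= m * (s * enorm g).
  apply: le_trans (sum_sub_le_enorm x y) _.
  have -> : enorm (y - x) = s * enorm g.
    rewrite /y addrAC subrr add0r.
    apply/eqP; rewrite -(eqrXn2 (n := 2))// ?enorm_ge0//; last first.
      by rewrite mulr_ge0 ?enorm_ge0// ltW.
    rewrite exprMn !sqr_enorm mulr_sumr; apply/eqP; apply: eq_bigr => i _.
    by rewrite !mxE; ring.
  by rewrite ler_wpM2r// mulr_ge0 ?enorm_ge0// ltW.
have S0 : 0 <= \sum_k `|y 0 k - x 0 k| by exact: sumr_ge0.
have S2 : (\sum_k `|y 0 k - x 0 k|) ^+ 2 <= (m * (s * enorm g)) ^+ 2.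
  by rewrite lerXn2r// nnegrE// (le_trans S0).
have Jy := Jmin y.
move=> H.
have E : L * (m * (s * enorm g)) ^+ 2 = s / 2 * enorm g ^+ 2.
  by rewrite /s /c; field; rewrite !gt_eqF.
have E2 : s * c = 2 by rewrite /s divfK// gt_eqF.
have H2 : s / 2 * enorm g ^+ 2 <= J x - J xstar.
  have : L * (\sum_k `|y 0 k - x 0 k|) ^+ 2 <= s / 2 * enorm g ^+ 2.
    by rewrite -E ler_wpM2l// ltW.
  lra.
have : c * (s / 2 * enorm g ^+ 2) <= c * (J x - J xstar) by rewrite ler_wpM2l// ltW.
have -> : c * (s / 2 * enorm g ^+ 2) = s * c / 2 * enorm g ^+ 2 by ring.
by rewrite E2 divff// mul1r.
Qed.

(** Taylor's formula at the minimizer. The constant is generous so as to coincide with the one of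
    [sqr_grad_le]. *)
Lemma J_le_sqr x : J x - J xstar <= 4 * L * n.+1%:R ^+ 2 * enorm (x - xstar) ^+ 2.
Proof.
set m : R := n.+1%:R; have m0 : 0 < m by rewrite ltr0n.
have nm : n%:R <= m by rewrite ler_nat.
have := taylor2 xstar x.
have -> : dotv (grad J xstar) (x - xstar) = 0.
  by rewrite grad0 /dotv big1// => i _; rewrite mxE mul0r.
rewrite subr0 ler_norml => /andP[_ H]; apply: le_trans H _.
have S0 : 0 <= \sum_k `|x 0 k - xstar 0 k| by exact: sumr_ge0.
have S2 : (\sum_k `|x 0 k - xstar 0 k|) ^+ 2 <= (m * enorm (x - xstar)) ^+ 2.
  rewrite lerXn2r// ?nnegrE// ?mulr_ge0 ?enorm_ge0//.
  by apply: le_trans (sum_sub_le_enorm _ _) _; rewrite ler_wpM2r ?enorm_ge0.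
have := ler_wpM2l (ltW L_gt0) S2; rewrite exprMn => H; apply: le_trans H _.
have q0 : 0 <= L * m ^+ 2 * enorm (x - xstar) ^+ 2.
  exact: (mulr_ge0 (mulr_ge0 (ltW L_gt0) (sqr_ge0 _)) (sqr_ge0 _)).
by lra.
Qed.

End BoundedHessian.

(** * Comparison functions *)

Section Comparison.
Variable R : realType.

(** Asking for [m (mu y) = |y|] makes the inverse of [m] total and continuous on the whole line. *)
Lemma increasing_inverse (m : R -> R) :
  continuous m -> m 0 = 0 ->
  (forall s t : R, 0 <= s -> s < t -> m s < m t) ->
  (forall M : R, exists2 r : R, 0 <= r & M <= m r) ->
  exists mu : R -> R, [/\ continuous mu, forall y, 0 <= mu y & forall y, m (mu y) = `|y|].
Proof.
move=> cm m0 incm unbm.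
have /choice[mu Hmu] : forall y : R, exists r : R, 0 <= r /\ m r = `|y|.
  move=> y; have [r r0 yr] := unbm `|y|.
  have [c + mc] := @IVT R m 0 r `|y| r0 (continuous_subspaceT cm)
    ltac:(by rewrite m0 ge_min normr_ge0 le_max yr orbT).
  by rewrite in_itv/= => /andP[c0 _]; exists c.
have mu_ge0 y : 0 <= mu y by have [] := Hmu y.
have muE y : m (mu y) = `|y| by have [] := Hmu y.
have mu_lt y r : 0 <= r -> `|y| < m r -> mu y < r.
  move=> r0; rewrite -muE; have [//|rmu] := ltP (mu y) r.
  by move: rmu; rewrite le_eqVlt => /orP[/eqP->|/(incm _ _ r0)/ltW];
    rewrite ?ltxx// leNgt => /negbTE ->.
have mu_gt y r : 0 <= r -> m r < `|y| -> r < mu y.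
  move=> r0; rewrite -muE; have [//|rmu] := ltP r (mu y).
  by move: rmu; rewrite le_eqVlt => /orP[/eqP->|/(incm _ _ (mu_ge0 y))/ltW];
    rewrite ?ltxx// leNgt => /negbTE ->.
exists mu; split=> // y; apply/cvgrPdist_lt => e e0.
have Hn (z : R) : `|z| @[z --> y] --> `|y| by apply: cvg_norm; exact: cvg_id.
have up : `|y| < m (mu y + e) by rewrite -muE incm// ltrDl.
have dn : \forall z \near y, 0 <= mu y - e -> m (mu y - e) < `|z|.
  have [ye|ye] := ltP (mu y - e) 0; first by near=> z.
  near=> z => _; near: z; apply: (cvgr_gt `|y|); first exact: Hn.
  by rewrite -muE; apply: incm => //; lra.
near=> z.
have z1 : mu z < mu y + e.
  apply: mu_lt; first by rewrite addr_ge0// ltW.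
  by near: z; apply: (cvgr_lt `|y|) => //; exact: Hn.
have z2 : mu y - e < mu z.
  have [ye|ye] := ltP (mu y - e) 0; first exact: lt_le_trans ye (mu_ge0 z).
  by apply: mu_gt => //; move: ye; near: z.
by rewrite ltr_norml; apply/andP; split; lra.
Unshelve. all: by end_near. Qed.

(** Solves [(1 + t) * m r <= C * s ^+ 2] for [r]: the bound is the inverse of [m] at
    [C * s ^+ 2 / (1 + t)]. *)
Lemma exists_KL (m : R -> R) (C : R) : 0 < C ->
  continuous m -> m 0 = 0 ->
  (forall s t : R, 0 <= s -> s < t -> m s < m t) ->
  (forall M : R, exists2 r : R, 0 <= r & M <= m r) ->
  exists2 beta : R -> R -> R, classKL beta & forall s t r : R,
    0 <= t -> 0 <= r -> (1 + t) * m r <= C * s ^+ 2 -> r <= beta s t.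
Proof.
move=> C0 cm m0 incm unbm.
have [mu [cmu mu_ge0 muE]] := increasing_inverse cm m0 incm unbm.
have incm' r s : 0 <= r -> 0 <= s -> m r < m s -> r < s.
  move=> r0 s0; have [//|] := ltP r s; rewrite le_eqVlt => /orP[/eqP->|/(incm _ _ s0)/ltW].
    by rewrite ltxx.
  by rewrite leNgt => /negbTE ->.
have incm'' r s : 0 <= r -> 0 <= s -> m r <= m s -> r <= s.
  move=> r0 s0 H; rewrite leNgt; apply/negP => /(incm _ _ s0).
  by rewrite ltNge H.
have arg_ge0 (s t : R) : 0 <= t -> 0 <= C * s ^+ 2 / (1 + t).
  by move=> t0; exact: (divr_ge0 (mulr_ge0 (ltW C0) (sqr_ge0 s)) (addr_ge0 ler01 t0)).
have E (s t : R) : 0 <= t -> m (mu (C * s ^+ 2 / (1 + t))) = C * s ^+ 2 / (1 + t).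
  by move=> t0; rewrite muE ger0_norm// arg_ge0.
exists (fun s t => mu (C * s ^+ 2 / (1 + t))); last first.
  move=> s t r t0 r0 H; apply: incm'' => //; rewrite E//.
  by rewrite ler_pdivlMr 1?mulrC// ltr_wpDr.
split; [|split].
- move=> t t0; split; [|split].
  + rewrite expr0n mulr0 mul0r; apply/eqP; rewrite eq_le mu_ge0 andbT.
    by apply: incm'' => //; rewrite muE normr0 m0.
  + apply: continuous_subspaceT => s.
    apply: (@continuous_comp _ _ _ (fun s : R => C * s ^+ 2 / (1 + t)) mu); last exact: cmu.
    apply: cvgM; last exact: cvg_cst.
    by apply: cvgM; [exact: cvg_cst | exact: exprn_continuous].
  + move=> s1 s2 s10 s12; apply: incm' => //; rewrite !E//.
    rewrite ltr_pM2r ?invr_gt0 ?ltr_wpDr// ltr_pM2l//.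
    by rewrite ltrXn2r// nnegrE// (le_trans s10)// ltW.
- move=> s t1 t2 s0 t10 t12; have t20 := le_trans t10 t12.
  apply: incm'' => //; rewrite !E// ler_wpM2l ?(mulr_ge0 (ltW C0) (sqr_ge0 s))//.
  by rewrite lef_pV2 ?posrE; lra.
- move=> s s0; apply/cvgr0Pnorm_lt => e e0.
  have me : 0 < m e by rewrite -m0 incm.
  near=> t.
  have t1 : 0 < t by near: t; exact: nbhs_pinfty_gt.
  have t2 : C * s ^+ 2 / m e < t by near: t; apply: nbhs_pinfty_gt; exact: num_real.
  rewrite ger0_norm//; apply: incm' => //; first exact: ltW.
  rewrite E ?ltW// ltr_pdivrMr; last by lra.
  move: t2; rewrite ltr_pdivrMr// => t2; nra.
Unshelve. all: by end_near. Qed.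

(** The assumed lower bound of |grad J|^2 at distance [r] from the minimizer. Absolute values make
    it continuous on the line, whereas [alpha] is controlled on the half-line only. *)
Definition gain (alpha : R -> R) (r : R) : R := (alpha `|r| * `|r|) ^+ 2.

Section Gain.
Variable alpha : R -> R.
Hypothesis alphaK : classK alpha.

Lemma classK_ge0 s : 0 <= s -> 0 <= alpha s.
Proof.
have [a0 [_ ai]] := alphaK.
rewrite le_eqVlt => /orP[/eqP<-|s0]; first by rewrite a0.
by rewrite -a0; apply/ltW/ai.
Qed.

Lemma classK_le s t : 0 <= s -> s <= t -> alpha s <= alpha t.
Proof.
have [a0 [_ ai]] := alphaK.
move=> s0; rewrite le_eqVlt => /orP[/eqP<-//|st]; exact/ltW/ai.
Qed.

Lemma gain_continuous : continuous (gain alpha).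
Proof.
have [a0 [ac ai]] := alphaK.
suff ca : continuous (fun r : R => alpha `|r|).
  move=> r; apply: (@continuous_comp _ _ _ (fun r : R => alpha `|r| * `|r|) (fun x : R => x ^+ 2)).
    by apply: cvgM; [exact: ca | apply: cvg_norm; exact: cvg_id].
  exact: exprn_continuous.
move=> r; have /subspace_continuousP := ac => /(_ `|r| (normr_ge0 r)) H.
apply: (@cvg_comp _ _ _ (fun r : R => `|r|) alpha _ (within [set s | 0 <= s] (nbhs `|r|))) => //.
move=> A /= HA.
have : \forall x \near r, 0 <= `|x| -> A `|x|.
  exact: (@cvg_norm _ _ _ (nbhs r) _ id r cvg_id _ HA).
by apply: filterS => x; apply.
Qed.

Lemma gain0 : gain alpha 0 = 0.
Proof. by rewrite /gain normr0 mulr0 expr0n. Qed.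

Lemma gain_ge0 r : 0 <= gain alpha r.
Proof. exact: sqr_ge0. Qed.

Lemma gain_lt (s t : R) : 0 <= s -> s < t -> gain alpha s < gain alpha t.
Proof.
have [a0 [_ ai]] := alphaK => s0 st; have t0 := le_lt_trans s0 st.
rewrite /gain !ger0_norm// ?ltW//.
have as0 := classK_ge0 s0; have ast := ai _ _ s0 st.
have at0 := le_lt_trans as0 ast.
rewrite ltrXn2r// ?nnegrE ?mulr_ge0// ?ltW//; nra.
Qed.

Lemma gain_le (s t : R) : 0 <= s -> s <= t -> gain alpha s <= gain alpha t.
Proof.
move=> s0; rewrite le_eqVlt => /orP[/eqP<-//|st]; exact/ltW/gain_lt.
Qed.

(** [alpha] is only of class K and may be bounded; for [r >= 1] the factor [r] compensates, as
    [gain alpha r >= alpha 1 ^+ 2 * r]. *)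
Lemma gain_unbounded M : exists2 r, 0 <= r & M <= gain alpha r.
Proof.
have [a0 [_ ai]] := alphaK.
have a1 : 0 < alpha 1 by rewrite -a0 ai.
pose r := 1 + `|M| / alpha 1 ^+ 2.
have M0 : 0 <= `|M| / alpha 1 ^+ 2 by rewrite divr_ge0 ?sqr_ge0.
have r1 : 1 <= r by rewrite /r; lra.
have r0 : 0 <= r by lra.
exists r => //; rewrite /gain ger0_norm// exprMn.
apply: (@le_trans _ _ (alpha 1 ^+ 2 * r)); last first.
  apply: ler_pM => //; rewrite ?sqr_ge0//; last by rewrite expr2; nra.
  by rewrite lerXn2r// ?nnegrE ?classK_ge0// classK_le.
rewrite mulrDr mulr1 mulrCA divff ?mulr1 ?expf_neq0 ?gt_eqF//.
have := ler_norm M; have := sqr_ge0 (alpha 1); lra.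
Qed.

(** The two premises are the outcome of the decay estimate: a bound free of [t] and one proportional
    to [t]. For the minimum [m] of the two gains they add up to [(1 + t) * m r <= (A + D) * s ^+ 2],
    the form solved by [exists_KL]. *)
Lemma exists_gain_KL (A B D k : R) : 0 < A -> 0 < B -> 0 < D -> 0 < k ->
  exists2 beta : R -> R -> R, classKL beta & forall s t r : R,
    0 <= t -> 0 <= r -> gain alpha r <= A * s ^+ 2 ->
    t * (k * gain alpha (Num.sqrt (gain alpha r / B))) <= D * s ^+ 2 ->
    r <= beta s t.
Proof.
move=> A0 B0 D0 k0.
pose p r := k * gain alpha (Num.sqrt (gain alpha r / B)).
pose m r := Num.min (p r) (gain alpha r).
have sqrt_lt s t : 0 <= s -> s < t ->
    Num.sqrt (gain alpha s / B) < Num.sqrt (gain alpha t / B).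
  move=> s0 st; have gst := gain_lt s0 st.
  rewrite ltr_sqrt ?ltr_pM2r ?invr_gt0// divr_gt0//.
  exact: le_lt_trans (gain_ge0 s) gst.
have p_lt s t : 0 <= s -> s < t -> p s < p t.
  by move=> s0 st; rewrite ltr_pM2l// gain_lt ?sqrtr_ge0// sqrt_lt.
have p_cont : continuous p.
  move=> r; apply: cvgM; first exact: cvg_cst.
  apply: (@continuous_comp _ _ _ (fun r => Num.sqrt (gain alpha r / B)) (gain alpha)); last exact: gain_continuous.
  apply: (@continuous_comp _ _ _ (fun r => gain alpha r / B) Num.sqrt); last exact: sqrt_continuous.
  by apply: cvgM; [exact: gain_continuous | exact: cvg_cst].
have AD : 0 < A + D by lra.
have [||||beta bKL Hbeta] := @exists_KL m (A + D) AD.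
- have -> : m = (fun r => (p r + gain alpha r - `|p r - gain alpha r|) / 2).
    by apply/funext => r; rewrite /m minr_absE.
  move=> r; have cp := p_cont r; have cg : {for r, continuous (gain alpha)} by exact: gain_continuous.
  apply: cvgM; last exact: cvg_cst.
  by apply: cvgB; [exact: cvgD | apply: cvg_norm; exact: cvgB].
- by rewrite /m /p gain0 mul0r sqrtr0 gain0 mulr0 minxx.
- move=> s t s0 st; rewrite lt_min !gt_min p_lt// gain_lt// orbT//.
- move=> M.
  have [r1 r10 Mr1] := gain_unbounded M.
  have [r2 r20 Mr2] := gain_unbounded (M / k).
  have [r3 r30 Mr3] := gain_unbounded (B * r2 ^+ 2).
  (* [r1] takes care of [gain]; [r3] makes the inner square root at least [r2], hence [p r >= M]. *)
  pose r := Num.max r1 r3.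
  exists r; first by rewrite le_max r10.
  rewrite le_min; apply/andP; split; last first.
    by apply: le_trans Mr1 _; rewrite gain_le// le_max lexx.
  rewrite /p mulrC -ler_pdivrMr//; apply: le_trans Mr2 _; apply: gain_le => //.
  rewrite -[r2]ger0_norm// -sqrtr_sqr ler_wsqrtr// ler_pdivlMr// mulrC.
  by apply: le_trans Mr3 _; rewrite gain_le// le_max lexx orbT.
exists beta => // s t r t0 r0 H1 H2; apply: Hbeta => //.
have m1 : m r <= gain alpha r by rewrite /m ge_min lexx orbT.
have m2 : m r <= p r by rewrite /m ge_min lexx.
have := ler_wpM2l t0 m2; rewrite -/(p r) in H2.
by rewrite mulrDl mul1r mulrDl; lra.
Qed.

End Gain.
End Comparison.

(** * Resonances and primitives *)

Section CurveDerivatives.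
Variable R : realType.
Implicit Types (f g h : R -> R) (t : R).

Lemma is_derive_sum_fin (I : finType) (F : I -> R -> R) (dF : I -> R) t :
  (forall i, is_derive t 1 (F i) (dF i)) ->
  is_derive t 1 (fun s => \sum_i F i s) (\sum_i dF i).
Proof.
move=> H; rewrite (_ : (fun s => _) = \sum_i F i); last first.
  by apply/funext => s; rewrite fct_sumE.
elim/big_ind2 : _ => //; first exact: is_derive_cst.
by move=> f df g dg Hf Hg; exact: is_deriveD.
Qed.

Lemma is_derive_sin_comp h t dh : is_derive t 1 h dh ->
  is_derive t 1 (fun s => sin (h s)) (cos (h t) * dh).
Proof. by move=> H; exact: (is_derive1_comp (is_derive_sin (h t)) H). Qed.

Lemma is_derive_ln_comp h t dh : 0 < h t -> is_derive t 1 h dh ->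
  is_derive t 1 (fun s => ln (h s)) ((h t)^-1 * dh).
Proof. by move=> h0 H; exact: (is_derive1_comp (is_derive1_ln h0) H). Qed.

Lemma is_derive_sqrt_comp h t dh : 0 < h t -> is_derive t 1 h dh ->
  is_derive t 1 (fun s => Num.sqrt (h s)) ((2 * Num.sqrt (h t))^-1 * dh).
Proof. by move=> h0 H; exact: (is_derive1_comp (is_derive1_sqrt h0) H). Qed.

Lemma is_derive_add f g t df dg : is_derive t 1 f df -> is_derive t 1 g dg ->
  is_derive t 1 (fun s => f s + g s) (df + dg).
Proof. by move=> Hf Hg; exact: is_deriveD. Qed.

Lemma is_derive_sub f g t df dg : is_derive t 1 f df -> is_derive t 1 g dg ->
  is_derive t 1 (fun s => f s - g s) (df - dg).
Proof. by move=> Hf Hg; exact: is_deriveB. Qed.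

Lemma is_derive_mul f g t df dg : is_derive t 1 f df -> is_derive t 1 g dg ->
  is_derive t 1 (fun s => f s * g s) (f t * dg + g t * df).
Proof. by move=> Hf Hg; exact: is_deriveM. Qed.

Lemma is_derive_cmul (c : R) f t df : is_derive t 1 f df ->
  is_derive t 1 (fun s => c * f s) (c * df).
Proof. by move=> Hf; exact: (is_deriveZ c Hf). Qed.

Lemma is_derive_phase (l tau : R -> R) (w p t dl dtau : R) :
  is_derive t 1 l dl -> is_derive t 1 tau dtau ->
  is_derive t 1 (fun s => l s + w * tau s - p) (dl + w * dtau).
Proof.
move=> Hl Ht; have := is_derive_sub (is_derive_add Hl (is_derive_cmul w Ht))
  (is_derive_cst p t 1).
by rewrite subr0.
Qed.

End CurveDerivatives.

Section Oscillation.
Variable R : realType.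
Implicit Types (w p l tau : R).

(** The average in [tau] of a product of two cosines with phases [l + w1 * tau - p1] and
    [l + w2 * tau - p2]: the difference of the phases is constant only at equal frequencies, and [l]
    cancels in it. *)
Definition cc_mean w1 w2 p1 p2 : R := if w1 == w2 then cos (p1 - p2) / 2 else 0.

(* A primitive in [tau] of [cos A * cos B - cc_mean], where
   [A = l + w1 * tau - p1] and [B = l + w2 * tau - p2]; when [w1 = w2] the
   factor [(w1 - w2)^-1] is [0], so the resonant term drops out. *)
Definition cc_prim w1 w2 p1 p2 l tau : R :=
  sin ((l + w1 * tau - p1) + (l + w2 * tau - p2)) / (2 * (w1 + w2)) +
  sin ((l + w1 * tau - p1) - (l + w2 * tau - p2)) / 2 * (w1 - w2)^-1.

(** The derivative of [cc_prim] in [l], which survives in the sum of the phases only. *)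
Definition cc_prim_l w1 w2 p1 p2 l tau : R :=
  cos ((l + w1 * tau - p1) + (l + w2 * tau - p2)) / (w1 + w2).

Definition cc_bound w1 w2 : R := (w1 + w2)^-1 + `|(w1 - w2)^-1|.

Lemma is_derive_cc_prim w1 w2 p1 p2 (l tau : R -> R) (t dl dtau : R) :
  0 < w1 -> 0 < w2 -> is_derive t 1 l dl -> is_derive t 1 tau dtau ->
  is_derive t 1 (fun s => cc_prim w1 w2 p1 p2 (l s) (tau s))
   (cc_prim_l w1 w2 p1 p2 (l t) (tau t) * dl +
    (cos (l t + w1 * tau t - p1) * cos (l t + w2 * tau t - p2)
      - cc_mean w1 w2 p1 p2) * dtau).
Proof.
move=> w10 w20 Hl Ht.
have HA := is_derive_phase w1 p1 Hl Ht; have HB := is_derive_phase w2 p2 Hl Ht.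
have H1 := is_derive_cmul (2 * (w1 + w2))^-1 (is_derive_sin_comp (is_derive_add HA HB)).
have H2 := is_derive_cmul (2^-1 * (w1 - w2)^-1) (is_derive_sin_comp (is_derive_sub HA HB)).
have := is_derive_add H1 H2.
rewrite (_ : (fun s => _) = (fun s => cc_prim w1 w2 p1 p2 (l s) (tau s))); last first.
  apply/funext => s; rewrite /cc_prim; congr (_ + _); first by rewrite mulrC.
  by rewrite mulrC mulrA.
move=> H; apply: is_derive_eq H _.
rewrite /cc_prim_l /cc_mean.
set A := l t + w1 * tau t - p1; set B := l t + w2 * tau t - p2.
have w12 : w1 + w2 != 0 by rewrite gt_eqF// addr_gt0.
have [E|E] := eqVneq w1 w2.
  have -> : A - B = p2 - p1 by rewrite /A /B E; ring.
  rewrite E subrr invr0 mulr0 mul0r addr0 cosD -[p1 - p2]opprB cosN.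
  have -> : p2 - p1 = A - B by rewrite /A /B E; ring.
  rewrite cosB E in w12 *; field.
  by [].
rewrite subr0 cosD cosB.
have w12' : w1 - w2 != 0 by rewrite subr_eq0.
by field; rewrite w12 w12'.
Qed.

Lemma cc_prim_le w1 w2 p1 p2 l tau : 0 < w1 -> 0 < w2 ->
  `|cc_prim w1 w2 p1 p2 l tau| <= cc_bound w1 w2.
Proof.
move=> w10 w20; have w12 : 0 < w1 + w2 by rewrite addr_gt0.
apply: le_trans (ler_normD _ _) _; apply: lerD.
  rewrite normrM (ger0_norm (x := _^-1)) ?invr_ge0 ?mulr_ge0 ?(ltW w12)//.
  rewrite invfM mulrA ler_piMl ?invr_ge0 ?(ltW w12)//.
  have := ler_norml (sin (l + w1 * tau - p1 + (l + w2 * tau - p2))) 1.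
  by rewrite sin_geN1 sin_le1 => H; lra.
rewrite normrM ler_piMl// normrM (ger0_norm (x := 2^-1))//.
have := ler_norml (sin (l + w1 * tau - p1 - (l + w2 * tau - p2))) 1.
by rewrite sin_geN1 sin_le1 => H; lra.
Qed.

Lemma cc_prim_l_le w1 w2 p1 p2 l tau : 0 < w1 -> 0 < w2 ->
  `|cc_prim_l w1 w2 p1 p2 l tau| <= cc_bound w1 w2.
Proof.
move=> w10 w20; have w12 : 0 < w1 + w2 by rewrite addr_gt0.
apply: (@le_trans _ _ ((w1 + w2)^-1)); last by rewrite lerDl.
rewrite normrM (ger0_norm (x := _^-1)) ?invr_ge0 ?(ltW w12)//.
rewrite ler_piMl ?invr_ge0 ?(ltW w12)//.
by rewrite ler_norml cos_geN1 cos_le1.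
Qed.

Lemma cc_mean_le w1 w2 p1 p2 : `|cc_mean w1 w2 p1 p2| <= 1 / 2.
Proof.
rewrite /cc_mean; case: ifP => _; last by rewrite normr0; lra.
rewrite normrM (ger0_norm (x := 2^-1))// ler_wpM2r//.
by rewrite ler_norml cos_geN1 cos_le1.
Qed.

End Oscillation.

(** * Second-order averaging *)

Section Averaging.
Variables (R : realType) (I : finType) (w ph : I -> R).
Hypothesis w_gt0 : forall a, 0 < w a.
Implicit Types (a b : I) (l tau : R).

Definition amp a : R := Num.sqrt (2 * w a).
Definition phase a l tau : R := l + w a * tau - ph a.
(** The derivative of [Num.sqrt j * sin (phase a (ln j) tau)] in [j] is this divided by
    [Num.sqrt j]. *)
Definition osc a l tau : R := sin (phase a l tau) / 2 + cos (phase a l tau).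
(** The sine in [osc] is a cosine delayed by [pi / 2], so both parts of [osc a * cos (phase b)] are
    instances of [cc_prim]. *)
Definition osc_prim a b l tau : R :=
  cc_prim (w a) (w b) (ph a) (ph b) l tau +
  cc_prim (w a) (w b) (ph a + pi / 2) (ph b) l tau / 2.
Definition osc_prim_l a b l tau : R :=
  cc_prim_l (w a) (w b) (ph a) (ph b) l tau +
  cc_prim_l (w a) (w b) (ph a + pi / 2) (ph b) l tau / 2.
Definition osc_mean a b : R :=
  cc_mean (w a) (w b) (ph a) (ph b) +
  cc_mean (w a) (w b) (ph a + pi / 2) (ph b) / 2.

Lemma is_derive_osc_prim a b (l tau : R -> R) (t dl dtau : R) :
  is_derive t 1 l dl -> is_derive t 1 tau dtau ->
  is_derive t 1 (fun s => osc_prim a b (l s) (tau s))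
   (osc_prim_l a b (l t) (tau t) * dl +
    (osc a (l t) (tau t) * cos (phase b (l t) (tau t)) - osc_mean a b) * dtau).
Proof.
move=> Hl Ht.
have H1 := is_derive_cc_prim (ph a) (ph b) (w_gt0 a) (w_gt0 b) Hl Ht.
have H2 := is_derive_cc_prim (ph a + pi / 2) (ph b) (w_gt0 a) (w_gt0 b) Hl Ht.
have := is_derive_add H1 (is_derive_cmul 2^-1 H2).
rewrite (_ : (fun s => _) = (fun s => osc_prim a b (l s) (tau s))); last first.
  by apply/funext => s; rewrite /osc_prim; congr (_ + _); rewrite mulrC.
move=> H; apply: is_derive_eq H _.
rewrite /osc_prim_l /osc /osc_mean /phase opprD [in cos (_ + (_ - _))]addrA cosBpihalf.
by field.
Qed.

(** Since [tau] runs at speed [eps ^- 2], the derivative of the first sum cancels the inputs of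
    order 1/eps. J moves at speed 1/eps inside it and leaves products [osc a * cos (phase b)] of
    order one; the second sum replaces them by their means. Here [c] is a coordinate of the input
    vectors and [d b] is their product with grad J. *)
Definition zcoord (eps : R) (c : I -> R) (x j tau : R) (d : I -> R) : R :=
  x - eps * (\sum_a c a * (amp a / w a) * (Num.sqrt j * sin (phase a (ln j) tau)))
  + eps ^+ 2 * (\sum_a \sum_b c a * (amp a / w a) * amp b *
                  (d b * osc_prim a b (ln j) tau)).

(** What neither correction cancels: the motion of [d] and of the phase [ln j] in the second sum,
    and the part [D0] of the velocity of J in the first. *)
Definition zrem (eps : R) (c : I -> R) (j tau D0 dJ : R) (d dd : I -> R) : R :=
  eps ^+ 2 * (\sum_a \sum_b c a * (amp a / w a) * amp b *
     (dd b * osc_prim a b (ln j) tau + d b * (osc_prim_l a b (ln j) tau * (j^-1 * dJ))))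
  - eps * (\sum_a c a * (amp a / w a) * ((Num.sqrt j)^-1 * osc a (ln j) tau * D0)).

Lemma is_derive_zcoord (eps : R) (c : I -> R) (x Jt tau : R -> R) (d : I -> R -> R)
    (t f D0 : R) (dd : I -> R) :
  eps != 0 -> 0 < Jt t ->
  let S := \sum_b d b t * amp b * cos (phase b (ln (Jt t)) (tau t)) in
  let dJ := D0 + eps^-1 * Num.sqrt (Jt t) * S in
  is_derive t 1 Jt dJ ->
  (forall b, is_derive t 1 (d b) (dd b)) ->
  is_derive t 1 tau (eps ^- 2) ->
  is_derive t 1 x (f + eps^-1 * \sum_a c a *
     (amp a * Num.sqrt (Jt t) * cos (phase a (ln (Jt t)) (tau t)))) ->
  is_derive t 1 (fun s => zcoord eps c (x s) (Jt s) (tau s) (d^~ s))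
   (f - \sum_a \sum_b c a * (amp a / w a) * amp b * (d b t * osc_mean a b)
    + zrem eps c (Jt t) (tau t) D0 dJ (d^~ t) dd).
Proof.
move=> e0 J0 S dJ HJ Hd Ht Hx.
have Hl := is_derive_ln_comp J0 HJ; have Hs := is_derive_sqrt_comp J0 HJ.
have H1 := is_derive_sum_fin (fun a => is_derive_cmul (c a * (amp a / w a))
  (is_derive_mul Hs (is_derive_sin_comp (is_derive_phase (w a) (ph a) Hl Ht)))).
have H2 := is_derive_sum_fin (fun a => is_derive_sum_fin (fun b =>
  is_derive_cmul (c a * (amp a / w a) * amp b)
  (is_derive_mul (Hd b) (is_derive_osc_prim a b Hl Ht)))).
apply: is_derive_eq
  (is_derive_add (is_derive_sub Hx (is_derive_cmul eps H1)) (is_derive_cmul (eps ^+ 2) H2)) _.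
clear Hx HJ Hl Hs H1 H2 Hd Ht.
rewrite /zrem; set j := Jt t in J0 dJ *; set y := Num.sqrt j in dJ *.
have y0 : y != 0 by rewrite gt_eqF// sqrtr_gt0.
have jE : j = y ^+ 2 by rewrite sqr_sqrtr// ltW.
set l := ln j; set T := tau t.
(* The derivative of the second correction splits into remainder terms, a fast part [X2] and the
   mean. *)
rewrite [X in eps ^+ 2 * X](_ : _ = \sum_a (
   \sum_b c a * (amp a / w a) * amp b *
     (dd b * osc_prim a b l T + d b t * (osc_prim_l a b l T * (j^-1 * dJ)))
   + (eps ^- 2 * (c a * (amp a / w a)) * osc a l T * S
     - eps ^- 2 * \sum_b c a * (amp a / w a) * amp b * (d b t * osc_mean a b)))); last first.
  apply: eq_bigr => a _; rewrite /S !mulr_sumr -sumrB -big_split/=.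
  by apply: eq_bigr => b _; rewrite -/j -/l -/T; ring.
rewrite big_split/= sumrB.
set X1 := \sum_i \sum_b _; set X3 := \sum_a \sum_b c a * _ * _ * (_ * osc_mean a b).
rewrite -mulr_sumr -/X3.
set X2 := \sum_i eps ^- 2 * _ * _ * _.
(* The cancellation of all fast terms; it holds for each [a] separately. *)
suff : eps^-1 * (\sum_a c a * (amp a * y * cos (phase a l T))) -
    eps * (\sum_a c a * (amp a / w a) * (y * (cos (l + w a * T - ph a) * (j^-1 * dJ + w a * eps ^- 2))
       + sin (l + w a * T - ph a) * ((2 * y)^-1 * dJ))) + eps ^+ 2 * X2
    = - (eps * (\sum_a c a * (amp a / w a) * (y^-1 * osc a l T * D0))).
  move=> H; have -> : eps ^+ 2 * (X1 + (X2 - eps ^- 2 * X3)) = eps ^+ 2 * X1 + eps ^+ 2 * X2 - X3.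
    by field.

  move: H; set u1 := eps^-1 * _; set u2 := eps * _; set u3 := eps ^+ 2 * X2; set u4 := eps * _ => H.
  have -> : u4 = - (u1 - u2 + u3) by rewrite H opprK.
  ring.
rewrite /X2 !mulr_sumr -sumrB -big_split -sumrN/=; apply: eq_bigr => a _.
rewrite /osc /phase -/(phase a l T) /dJ jE.
have wa : w a != 0 by rewrite gt_eqF.
by field; rewrite e0 y0 wa.
Qed.

End Averaging.

Lemma coordB (R : zmodType) n (u v : 'rV[R]_n) k : (u - v) 0 k = u 0 k - v 0 k.
Proof. by rewrite !mxE. Qed.

Lemma norm_sum_le (R : numDomainType) (I : finType) (F G : I -> R) :
  (forall i, `|F i| <= G i) -> `|\sum_i F i| <= \sum_i G i.
Proof. by move=> H; apply: le_trans (ler_norm_sum _ _ _) _; exact: ler_sum. Qed.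

Lemma norm_dotv_le (R : realType) n (u v : 'rV[R]_n) :
  `|dotv u v| <= enorm u * enorm v.
Proof.
rewrite ler_norml dotv_le andbT lerNl.
have -> : - dotv u v = dotv (- u) v.
  by rewrite /dotv -sumrN; apply: eq_bigr => i _; rewrite mxE mulNr.
apply: le_trans (dotv_le _ _) _.
rewrite ler_wpM2r ?enorm_ge0// /enorm ler_wsqrtr//.
by apply: ler_sum => i _; rewrite mxE sqrrN.
Qed.

(** * Size of the change of variables and of its remainder *)

Section AveragedBounds.
Variables (R : realType) (n : nat) (I : finType) (B : I -> 'rV[R]_n) (w ph : I -> R).
Hypothesis w_gt0 : forall a, 0 < w a.
Implicit Types (a b : I) (l tau : R).

Let bet a : R := enorm (B a).
Let Q : R := \sum_a bet a * (amp w a / w a).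
Let P : R := \sum_b bet b * amp w b.
(** Summing over all pairs dominates every [osc_prim] and [osc_prim_l]; the factor 2 covers their
    two terms, of weights 1 and 1/2. *)
Let K : R := \sum_a \sum_b 2 * cc_bound (w a) (w b).

Lemma amp_ge0 a : 0 <= amp w a.
Proof. exact: sqrtr_ge0. Qed.

Let ampw_ge0 a : 0 <= amp w a / w a.
Proof. by rewrite divr_ge0 ?amp_ge0// ltW. Qed.

Let bet_ge0 a : 0 <= bet a.
Proof. exact: enorm_ge0. Qed.

Let Q_ge0 : 0 <= Q.
Proof. by apply: sumr_ge0 => a _; rewrite mulr_ge0. Qed.

Let P_ge0 : 0 <= P.
Proof. by apply: sumr_ge0 => a _; rewrite mulr_ge0 ?amp_ge0. Qed.

Let cc_bound_ge0 a b : 0 <= cc_bound (w a) (w b).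
Proof. by rewrite addr_ge0// invr_ge0 addr_ge0// ltW. Qed.

Let cc_bound_le a b : 2 * cc_bound (w a) (w b) <= K.
Proof.
have H a' b' : 0 <= 2 * cc_bound (w a') (w b') by rewrite mulr_ge0.
rewrite /K (bigD1 a)//= (bigD1 b)//= -addrA lerDl addr_ge0//.
  by apply: sumr_ge0.
by apply: sumr_ge0 => c _; apply: sumr_ge0.
Qed.

Let K_ge0 : 0 <= K.
Proof. by apply: sumr_ge0 => a _; apply: sumr_ge0 => b _; rewrite mulr_ge0. Qed.

Let osc_le a l tau : `|osc w ph a l tau| <= 2.
Proof.
rewrite /osc; set s := sin _; set c := cos _.
have s1 : `|s| <= 1 by rewrite ler_norml sin_geN1 sin_le1.
have c1 : `|c| <= 1 by rewrite ler_norml cos_geN1 cos_le1.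
apply: le_trans (ler_normD _ _) _.
rewrite normrM (ger0_norm (x := 2^-1))//; lra.
Qed.

Let osc_prim_le a b l tau : `|osc_prim w ph a b l tau| <= K.
Proof.
apply: le_trans (cc_bound_le a b); apply: le_trans (ler_normD _ _) _.
rewrite [X in _ + X <= _]normrM (ger0_norm (x := 2^-1))//.
have := cc_prim_le (ph a) (ph b) l tau (w_gt0 a) (w_gt0 b).
have := cc_prim_le (ph a + pi / 2) (ph b) l tau (w_gt0 a) (w_gt0 b).
have := cc_bound_ge0 a b; lra.
Qed.

Let osc_prim_l_le a b l tau : `|osc_prim_l w ph a b l tau| <= K.
Proof.
apply: le_trans (cc_bound_le a b); apply: le_trans (ler_normD _ _) _.
rewrite [X in _ + X <= _]normrM (ger0_norm (x := 2^-1))//.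
have := cc_prim_l_le (ph a) (ph b) l tau (w_gt0 a) (w_gt0 b).
have := cc_prim_l_le (ph a + pi / 2) (ph b) l tau (w_gt0 a) (w_gt0 b).
have := cc_bound_ge0 a b; lra.
Qed.

Let osc_mean_le a b : `|osc_mean w ph a b| <= 1.
Proof.
apply: le_trans (ler_normD _ _) _.
rewrite [X in _ + X <= _]normrM (ger0_norm (x := 2^-1))//.
have := cc_mean_le (w a) (w b) (ph a) (ph b).
have := cc_mean_le (w a) (w b) (ph a + pi / 2) (ph b); lra.
Qed.

Let sum1_le (c Y : I -> R) (M : R) : (forall a, `|c a| <= bet a) ->
  (forall a, `|Y a| <= M) -> `|\sum_a c a * (amp w a / w a) * Y a| <= Q * M.
Proof.
move=> cb YM; rewrite mulr_suml; apply: norm_sum_le => a.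
rewrite normrM ler_pM// normrM (ger0_norm (ampw_ge0 a)) ler_wpM2r//.
Qed.

Let sum2_le (c : I -> R) (Y : I -> I -> R) (M : R) : (forall a, `|c a| <= bet a) ->
  (forall a b, `|Y a b| <= bet b * M) ->
  `|\sum_a \sum_b c a * (amp w a / w a) * amp w b * Y a b| <= Q * (P * M).
Proof.
move=> cb YM.
rewrite (eq_bigr (fun a => c a * (amp w a / w a) * \sum_b amp w b * Y a b)); last first.
  by move=> a _; rewrite mulr_sumr; apply: eq_bigr => b _; rewrite -!mulrA.
apply: sum1_le => // a; rewrite mulr_suml; apply: norm_sum_le => b.
by rewrite normrM (ger0_norm (amp_ge0 b)) [bet b * _]mulrC -mulrA ler_wpM2l ?amp_ge0.
Qed.

Lemma zcoord_le (eps : R) (c : I -> R) (x j tau G : R) (d : I -> R) : 0 < eps ->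
  (forall a, `|c a| <= bet a) -> (forall b, `|d b| <= bet b * G) -> 0 <= G ->
  `|zcoord w ph eps c x j tau d - x| <= eps * (Q * Num.sqrt j) + eps ^+ 2 * (Q * (P * (G * K))).
Proof.
move=> e0 cb db G0; rewrite /zcoord.
set s1 := \sum_a c a * _ * (Num.sqrt _ * _); set s2 := (X in _ ^+ 2 * X).
have -> : x - eps * s1 + eps ^+ 2 * s2 - x = eps ^+ 2 * s2 - eps * s1 by ring.
rewrite addrC; apply: le_trans (ler_normD _ _) _.
rewrite normrN [`|eps * _|]normrM [`|eps ^+ 2 * _|]normrM (gtr0_norm e0) (gtr0_norm (exprn_gt0 2 e0)).
apply: lerD; rewrite ler_wpM2l ?(ltW e0) ?(ltW (exprn_gt0 2 e0))//.
  apply: sum1_le => // a; rewrite normrM (ger0_norm (sqrtr_ge0 j)) ler_piMr ?sqrtr_ge0//.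
  by rewrite ler_norml sin_geN1 sin_le1.
apply: sum2_le => // a b; rewrite normrM mulrA; apply: ler_pM => //; exact: db.
Qed.

(** [G] stands for |grad J| and [E] for its velocity. [E] and [dJ] will be of order 1/eps, so the
    part with [eps ^+ 2] is of order eps too. *)
Lemma zrem_le (eps : R) (c : I -> R) (j tau D0 dJ G E : R) (d dd : I -> R) :
  0 < eps -> 0 < j -> 0 <= G ->
  (forall a, `|c a| <= bet a) -> (forall b, `|d b| <= bet b * G) ->
  (forall b, `|dd b| <= bet b * E) ->
  `|zrem w ph eps c j tau D0 dJ d dd| <=
    eps ^+ 2 * (Q * (P * (E * K + G * (K * (`|dJ| / j))))) +
    eps * (Q * (2 * `|D0| / Num.sqrt j)).
Proof.
move=> e0 j0 G0 cb db ddb; rewrite /zrem.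
have y0 : 0 < Num.sqrt j by rewrite sqrtr_gt0.
apply: le_trans (ler_normB _ _) _.
rewrite [`|eps * _|]normrM [`|eps ^+ 2 * _|]normrM (gtr0_norm e0) (gtr0_norm (exprn_gt0 2 e0)).
apply: lerD; rewrite ler_wpM2l ?(ltW e0) ?(ltW (exprn_gt0 2 e0))//.
  apply: sum2_le => // a b; rewrite [leRHS]mulrDr; apply: le_trans (ler_normD _ _) _.
  apply: lerD; first by rewrite normrM [leRHS]mulrA; apply: ler_pM => //; exact: ddb.
  rewrite normrM [leRHS]mulrA; apply: ler_pM => //.
  rewrite normrM; apply: ler_pM => //.
  by rewrite normrM mulrC normfV (gtr0_norm j0).
apply: sum1_le => // a; rewrite !normrM normfV (gtr0_norm y0).
have v0 : 0 <= (Num.sqrt j)^-1 by rewrite invr_ge0 ltW.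
have H := ler_wpM2l (mulr_ge0 v0 (normr_ge0 D0)) (osc_le a (ln j) tau).
apply: le_trans (_ : _ <= (Num.sqrt j)^-1 * `|D0| * `|osc w ph a (ln j) tau|) _.
  by rewrite mulrAC.
by apply: le_trans H _; rewrite mulrC mulrA mulrAC.
Qed.

Lemma osc_mean_sum_le (c d : I -> R) (G : R) : 0 <= G ->
  (forall a, `|c a| <= bet a) -> (forall b, `|d b| <= bet b * G) ->
  `|\sum_a \sum_b c a * (amp w a / w a) * amp w b * (d b * osc_mean w ph a b)|
    <= Q * (P * G).
Proof.
move=> G0 cb db; apply: sum2_le => // a b; rewrite normrM -[leRHS]mulr1.
by apply: ler_pM => //; exact: db.
Qed.

Lemma force_le (d : I -> R) (ps : I -> R) (G : R) :
  (forall b, `|d b| <= bet b * G) -> (forall b, `|ps b| <= 1) ->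
  `|\sum_b d b * amp w b * ps b| <= P * G.
Proof.
move=> db p1; rewrite mulr_suml; apply: norm_sum_le => b.
rewrite normrM -[leRHS]mulr1; apply: ler_pM => //.
by rewrite normrM (ger0_norm (amp_ge0 b)) mulrAC ler_wpM2r ?amp_ge0.
Qed.

End AveragedBounds.

(** * Decay of the averaged Lyapunov function *)

Section AveragedLyapunov.
Variables (R : realType) (n : nat) (I : finType) (B : I -> 'rV[R]_n) (w ph : I -> R).
Hypothesis w_gt0 : forall a, 0 < w a.
Variables (J : 'rV[R]_n -> R) (L : R) (b0 : 'rV[R]_n -> 'rV[R]_n) (kappa gam : R).
Variable xstar : 'rV[R]_n.
Hypothesis JC2 : C2 J.
Hypothesis L_gt0 : 0 < L.
Hypothesis JL : forall x, hess_norm J x <= L.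
Hypothesis Jmin : forall x, J xstar <= J x.
Hypothesis kappa_ge0 : 0 <= kappa.
Hypothesis b0_le : forall x, enorm (b0 x) <= kappa * enorm (grad J x).
Hypothesis excitation : forall v, gam * enorm v ^+ 2 <= \sum_a dotv (B a) v ^+ 2.
(** The resonance condition: the skew part of the mean matrix drops out of this quadratic form. *)
Hypothesis mean_quad : forall d : I -> R,
  \sum_a \sum_b d a * (amp w a / w a) * amp w b * (d b * osc_mean w ph a b) =
  \sum_a d a ^+ 2.
Local Notation V := 'rV[R]_n.
Implicit Types (x : V) (tau : R).

Definition zmap (eps : R) x tau : V :=
  \row_m zcoord w ph eps (fun a => B a 0 m) (x 0 m) (J x) tau
           (fun b => dotv (B b) (grad J x)).

Definition osc_field (eps : R) x tau (m : 'I_n) : R :=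
  b0 x 0 m + eps^-1 * \sum_a B a 0 m *
     (amp w a * Num.sqrt (J x) * cos (phase w ph a (ln (J x)) tau)).

Let bet a : R := enorm (B a).
Let Q : R := \sum_a bet a * (amp w a / w a).
Let P : R := \sum_b bet b * amp w b.
Let K : R := \sum_a \sum_b 2 * cc_bound (w a) (w b).
Let N : R := n%:R.
Variables c2 c3 : R.
Hypotheses (c2_ge0 : 0 <= c2) (c3_ge0 : 0 <= c3).

Definition comparable_region x : Prop :=
  [/\ 0 < J x, Num.sqrt (J x) <= c2 * enorm (grad J x) &
      enorm (grad J x) <= c3 * Num.sqrt (J x)].

(** In units of |grad J|: [CZ] bounds the displacement z - x and [CR] the remainder, both up to a
    factor eps, and [CD] bounds the velocity of z, made of drift, mean and remainder. *)
Let CZ : R := Q * (c2 + P * K).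
Let CR : R := Q * P * K * (N ^+ 2 * L * (kappa + P * c2) + kappa * c3 ^+ 2 + P * c3)
              + Q * (2 * kappa * c3).
Let CD : R := kappa + Q * P + CR.

Let Q_ge0 : 0 <= Q.
Proof. by apply: sumr_ge0 => a _; rewrite mulr_ge0 ?enorm_ge0// divr_ge0 ?amp_ge0// ltW. Qed.

Let P_ge0 : 0 <= P.
Proof. by apply: sumr_ge0 => a _; rewrite mulr_ge0 ?enorm_ge0// amp_ge0. Qed.

Let K_ge0 : 0 <= K.
Proof.
apply: sumr_ge0 => a _; apply: sumr_ge0 => b _.
by rewrite mulr_ge0// addr_ge0// invr_ge0 addr_ge0// ltW.
Qed.

Let N_ge0 : 0 <= N. Proof. exact: ler0n. Qed.

Let CZ_ge0 : 0 <= CZ.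
Proof. by rewrite /CZ; repeat (apply: mulr_ge0 || apply: addr_ge0). Qed.

Let CR_ge0 : 0 <= CR.
Proof.
have L0 := ltW L_gt0; have sN := sqr_ge0 N; have sc := sqr_ge0 c3.
by rewrite /CR; repeat first [exact: sN | exact: sc | apply: mulr_ge0 | apply: addr_ge0].
Qed.

Let CD_ge0 : 0 <= CD.
Proof. by rewrite /CD addr_ge0// addr_ge0// mulr_ge0. Qed.

Let coordB_le m a : `|B a 0 m| <= bet a.
Proof. exact: coord_enorm. Qed.

Let dotB_le x b : `|dotv (B b) (grad J x)| <= bet b * enorm (grad J x).
Proof. exact: norm_dotv_le. Qed.

Lemma zmap_sub_le eps x tau m : 0 < eps -> eps <= 1 -> comparable_region x ->
  `|zmap eps x tau 0 m - x 0 m| <= eps * (CZ * enorm (grad J x)).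
Proof.
move=> e0 e1 [J0 yG Gy]; rewrite mxE; set G := enorm _ in yG Gy *.
have G0 : 0 <= G by exact: enorm_ge0.
apply: le_trans (zcoord_le ph w_gt0 _ _ _ e0 (coordB_le m) (dotB_le x) (enorm_ge0 _)) _.
rewrite -/G -/Q -/P -/K expr2 -[eps * eps * _]mulrA -mulrDr ler_wpM2l// ?(ltW e0)//.
rewrite /CZ -mulrA mulrDl mulrDr; apply: lerD.
  by rewrite ler_wpM2l.
rewrite (_ : Q * (P * K * G) = Q * (P * (G * K))); last by ring.
by rewrite ler_piMl// !mulr_ge0.
Qed.

(** The displacement is of order eps |grad J|, so Taylor's formula gives an error in |grad J|^2,
    which can be compared with J - J xstar at any distance. *)
Lemma lyapunov_close x tau eps : 0 < eps -> eps <= 1 -> comparable_region x ->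
  `|J (zmap eps x tau) - J x| <=
    eps * ((N * CZ + L * (N * CZ) ^+ 2) * enorm (grad J x) ^+ 2).
Proof.
move=> e0 e1 Hx; have Hz m := zmap_sub_le tau m e0 e1 Hx.
set z := zmap eps x tau in Hz *; set G := enorm _ in Hz *.
have G0 : 0 <= G by exact: enorm_ge0.
have S1 : \sum_k `|z 0 k - x 0 k| <= N * (eps * (CZ * G)).
  rewrite (eq_bigr (fun k => `|(z - x) 0 k|)); last by move=> k _; rewrite coordB.
  by apply: sum_coord_le => k; rewrite coordB.
have := taylor2 JC2 L_gt0 JL x z; move: S1; set S := \sum_k _ => S1 HT.
have S0 : 0 <= S by exact: sumr_ge0.
have Hd : `|dotv (grad J x) (z - x)| <= G * S.
  rewrite mulr_sumr; apply: norm_sum_le => m; rewrite coordB normrM.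
  by rewrite ler_wpM2r// coord_enorm.
rewrite -(subrK (dotv (grad J x) (z - x)) (J z - J x)).
apply: le_trans (ler_normD _ _) _; apply: le_trans (lerD HT Hd) _.
have c0 : 0 <= N * CZ * G by exact: mulr_ge0 (mulr_ge0 N_ge0 CZ_ge0) G0.
have S2 : S <= eps * (N * CZ * G) by rewrite (le_trans S1)// !mulrA [N * eps]mulrC.
have S3 : S ^+ 2 <= eps * (N * CZ * G) ^+ 2.
  apply: (@le_trans _ _ ((eps * (N * CZ * G)) ^+ 2)).
    by rewrite lerXn2r// nnegrE// mulr_ge0// ltW.
  by rewrite exprMn ler_wpM2r ?sqr_ge0// expr2 ler_piMl// ltW.
have T1 := ler_wpM2l (ltW L_gt0) S3.
have T2 := ler_wpM2l G0 S2.
apply: le_trans (lerD T1 T2) _.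
by rewrite le_eqVlt; apply/orP; left; apply/eqP; ring.
Qed.

Section AlongSolution.
Variables (eps : R) (x : R -> V) (tau : R -> R) (t : R).
Hypotheses (eps_gt0 : 0 < eps) (eps_le1 : eps <= 1).
Hypothesis tau_deriv : is_derive t 1 tau (eps ^- 2).
Hypothesis x_deriv : forall m, is_derive t 1 (fun s => x s 0 m) (osc_field eps (x t) (tau t) m).
Hypothesis x_region : comparable_region (x t).

Let G : R := enorm (grad J (x t)).
Let y : R := Num.sqrt (J (x t)).
Let l : R := ln (J (x t)).
Let T : R := tau t.
Let S : R := \sum_b dotv (B b) (grad J (x t)) * amp w b * cos (phase w ph b l T).
Let D0 : R := dotv (grad J (x t)) (b0 (x t)).
Let dJ : R := D0 + eps^-1 * y * S.
Let dd b : R := \sum_m B b 0 m *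
  \sum_k partial k (partial m J) (x t) * osc_field eps (x t) (tau t) k.
Let mean m : R := \sum_a \sum_b B a 0 m * (amp w a / w a) * amp w b *
  (dotv (B b) (grad J (x t)) * osc_mean w ph a b).
Let rem m : R := zrem w ph eps (fun a => B a 0 m) (J (x t)) T D0 dJ
  (fun b => dotv (B b) (grad J (x t))) dd.

Let G_ge0 : 0 <= G. Proof. exact: enorm_ge0. Qed.
Let J_gt0 : 0 < J (x t). Proof. by case: x_region. Qed.
Let y_gt0 : 0 < y. Proof. by rewrite sqrtr_gt0. Qed.
Let yG : y <= c2 * G. Proof. by case: x_region. Qed.
Let Gy : G <= c3 * y. Proof. by case: x_region. Qed.

Lemma is_derive_zmap m : is_derive t 1 (fun s => zmap eps (x s) (tau s) 0 m)
  (b0 (x t) 0 m - mean m + rem m).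
Proof.
have HJ : is_derive t 1 (fun s => J (x s)) dJ.
  apply: is_derive_eq (is_derive_J_curve JC2 L_gt0 JL x_deriv) _.
  rewrite /dJ /D0 /S /osc_field -/y -/l -/T /dotv.
  under eq_bigr do rewrite mulrDr.
  rewrite big_split/=; congr (_ + _).
  rewrite (eq_bigr (fun i => \sum_a grad J (x t) 0 i * (eps^-1 * (B a 0 i *
    (amp w a * y * cos (phase w ph a l T)))))); last first.
    by move=> i _; rewrite !mulr_sumr.
  rewrite exchange_big/= mulr_sumr; apply: eq_bigr => a _.
  by rewrite !mulr_suml mulr_sumr; apply: eq_bigr => k _; ring.
have Hd b : is_derive t 1 (fun s => dotv (B b) (grad J (x s))) (dd b).
  have H := is_derive_sum_fin (fun m => is_derive_cmul (B b 0 m)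
    (is_derive_partial_curve JC2 m x_deriv)).
  rewrite (_ : (fun s => _) = (fun s => \sum_m B b 0 m * partial m J (x s)))//.
  by apply/funext => s; apply: eq_bigr => k _; rewrite mxE.
have := is_derive_zcoord w_gt0 (x := fun s => x s 0 m) (c := fun a => B a 0 m)
  (Jt := fun s => J (x s)) (tau := tau) (d := fun b s => dotv (B b) (grad J (x s)))
  (lt0r_neq0 eps_gt0) J_gt0 HJ Hd tau_deriv (x_deriv m).
by rewrite (_ : (fun s => _) = (fun s => zmap eps (x s) (tau s) 0 m))//;
  apply/funext => s; rewrite mxE.
Qed.

Let D0_le : `|D0| <= kappa * G ^+ 2.
Proof.
apply: le_trans (norm_dotv_le _ _) _; rewrite -/G expr2 mulrA mulrC.
by rewrite ler_wpM2r// b0_le.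
Qed.

Let S_le : `|S| <= P * G.
Proof.
apply: force_le; first exact: dotB_le.
by move=> b; rewrite ler_norml cos_geN1 cos_le1.
Qed.

Let field_le m : `|osc_field eps (x t) (tau t) m| <= (kappa + eps^-1 * (P * c2)) * G.
Proof.
apply: le_trans (ler_normD _ _) _; rewrite mulrDl; apply: lerD.
  by apply: le_trans (coord_enorm _ _) (b0_le _).
rewrite normrM normfV (gtr0_norm eps_gt0) -mulrA ler_wpM2l ?invr_ge0 ?(ltW eps_gt0)//.
apply: (@le_trans _ _ (P * y)); last by rewrite -mulrA ler_wpM2l.
rewrite mulr_suml; apply: norm_sum_le => a; rewrite normrM -[leRHS]mulrA; apply: ler_pM => //.
rewrite normrM ger0_norm ?mulr_ge0 ?amp_ge0 ?sqrtr_ge0//.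
by rewrite -/y ler_piMr ?mulr_ge0 ?amp_ge0 ?sqrtr_ge0// ler_norml cos_geN1 cos_le1.
Qed.

Let dd_le b : `|dd b| <= bet b * (N ^+ 2 * L * ((kappa + eps^-1 * (P * c2)) * G)).
Proof.
set M := (kappa + _) * G.
have M0 : 0 <= M.
  by rewrite mulr_ge0// addr_ge0// mulr_ge0 ?invr_ge0 ?(ltW eps_gt0)// mulr_ge0.
have H m : `|B b 0 m * \sum_k partial k (partial m J) (x t) * osc_field eps (x t) (tau t) k| <=
   bet b * (N * (L * M)).
  rewrite normrM; apply: ler_pM => //.
  rewrite /N mulr_natl -[n in leRHS]card_ord -sumr_const; apply: norm_sum_le => k.
  rewrite normrM; apply: ler_pM => //; exact: second_partial_le.
apply: le_trans (norm_sum_le H) _.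
rewrite sumr_const card_ord -mulr_natl -/N le_eqVlt; apply/orP; left; apply/eqP; ring.
Qed.

(** [dJ / J] is the speed of the phase [ln J]; being of order 1/eps, it is slow compared with the
    speed [eps ^- 2] of [tau]. *)
Let ratio_le : `|dJ| / J (x t) <= kappa * c3 ^+ 2 + eps^-1 * (P * c3).
Proof.
have Jy : J (x t) = y ^+ 2 by rewrite sqr_sqrtr// ltW.
have ei0 : 0 <= eps^-1 by rewrite invr_ge0 ltW.
rewrite ler_pdivrMr// Jy mulrDl.
apply: le_trans (ler_normD _ _) _; apply: lerD.
  apply: le_trans D0_le _; rewrite -mulrA -exprMn ler_wpM2l// lerXn2r// nnegrE//.
  by rewrite mulr_ge0// ltW.
rewrite normrM (ger0_norm (x := eps^-1 * y)) ?mulr_ge0 ?(ltW y_gt0)//.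
have -> : eps^-1 * (P * c3) * y ^+ 2 = eps^-1 * y * (P * (c3 * y)) by ring.
rewrite ler_wpM2l ?mulr_ge0 ?(ltW y_gt0)//.
by apply: le_trans S_le _; rewrite ler_wpM2l.
Qed.

Lemma rem_le m : `|rem m| <= eps * (CR * G).
Proof.
have ei0 : 0 <= eps^-1 by rewrite invr_ge0 ltW.
have L0 := ltW L_gt0.
apply: le_trans (zrem_le ph w_gt0 T D0 dJ eps_gt0 J_gt0 G_ge0 (coordB_le m) (dotB_le (x t)) dd_le) _.
rewrite -/Q -/P -/K -/y /CR [in leRHS]mulrDl mulrDr; apply: lerD; last first.
  rewrite ler_wpM2l ?(ltW eps_gt0)// -[leRHS]mulrA ler_wpM2l// ler_pdivrMr//.
  have H : `|D0| <= kappa * (G * (c3 * y)).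
    by apply: le_trans D0_le _; rewrite expr2 ler_wpM2l// ler_wpM2l.
  have -> : 2 * kappa * c3 * G * y = 2 * (kappa * (G * (c3 * y))) by ring.
  by rewrite ler_wpM2l.
have e2 : eps ^+ 2 * eps^-1 = eps by rewrite expr2 mulfK// gt_eqF.
have e3 : eps ^+ 2 <= eps by rewrite expr2 ler_piMl// ltW.
have rl := ratio_le; set r := `|dJ| / J (x t) in rl *.
have H1 : G * (K * r) <= G * (K * (kappa * c3 ^+ 2 + eps^-1 * (P * c3))).
  exact: ler_wpM2l G_ge0 _ _ (ler_wpM2l K_ge0 rl).
set E := N ^+ 2 * L * _.
apply: (@le_trans _ _ (eps ^+ 2 * (Q * (P * (E * K + G * (K * (kappa * c3 ^+ 2 + eps^-1 * (P * c3)))))))).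
  by rewrite ler_wpM2l ?sqr_ge0// ler_wpM2l// ler_wpM2l// lerD2l.
rewrite /E.
(* Sorted by powers of eps: the terms carrying [eps^-1] end at order eps, the others at order
   [eps ^+ 2 <= eps]. *)
have -> : eps ^+ 2 * (Q * (P * (N ^+ 2 * L * ((kappa + eps^-1 * (P * c2)) * G) * K +
   G * (K * (kappa * c3 ^+ 2 + eps^-1 * (P * c3)))))) =
   eps ^+ 2 * (Q * P * K * (N ^+ 2 * L * kappa + kappa * c3 ^+ 2) * G)
   + eps ^+ 2 * eps^-1 * (Q * P * K * (N ^+ 2 * L * (P * c2) + P * c3) * G) by ring.
rewrite e2.
have X0 : 0 <= Q * P * K * (N ^+ 2 * L * kappa + kappa * c3 ^+ 2) * G.
  have sN := sqr_ge0 N; have sc := sqr_ge0 c3.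
  by repeat first [exact: sN | exact: sc | apply: mulr_ge0 | apply: addr_ge0].
apply: le_trans (lerD (ler_wpM2r X0 e3) (lexx _)) _.
by rewrite le_eqVlt; apply/orP; left; apply/eqP; ring.
Qed.

(** The derivative of J(z) involves grad J at z, the velocity grad J at x. The Hessian bound lets
    one replace the other at a cost of order eps |grad J|^2. *)
Lemma lyapunov_derive : exists2 D, is_derive t 1 (fun s => J (zmap eps (x s) (tau s))) D &
  D <= - ((gam - kappa) - eps * (N * CR + N ^+ 2 * L * CZ * CD)) * G ^+ 2.
Proof.
exists (\sum_m grad J (zmap eps (x t) (tau t)) 0 m * (b0 (x t) 0 m - mean m + rem m)).
  exact: is_derive_J_curve JC2 L_gt0 JL _ _ _ is_derive_zmap.
set z := zmap _ _ _; set v := fun m => b0 (x t) 0 m - mean m + rem m.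
have mean_le m : `|mean m| <= Q * (P * G).
  exact: (osc_mean_sum_le ph w_gt0 G_ge0 (coordB_le m) (dotB_le (x t))).
have v_le m : `|v m| <= CD * G.
  apply: le_trans (ler_normD _ _) _.
  apply: le_trans (lerD (ler_normB _ _) (rem_le m)) _.
  have b := le_trans (coord_enorm (b0 (x t)) m) (b0_le (x t)); rewrite -/G in b.
  have r : eps * (CR * G) <= CR * G by rewrite ler_piMl// mulr_ge0.
  have := mean_le m; rewrite /CD mulrA => M; nra.
have zx m : `|z 0 m - x t 0 m| <= eps * (CZ * G).
  exact: zmap_sub_le.
have dg m : `|grad J z 0 m - grad J (x t) 0 m| <= L * (N * (eps * (CZ * G))).
  rewrite !mxE; apply: le_trans (partial_lipschitz JC2 JL _ _ _) _.
  rewrite ler_wpM2l ?(ltW L_gt0)//.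
  rewrite (eq_bigr (fun k => `|(z - x t) 0 k|)); last by move=> k _; rewrite coordB.
  by apply: sum_coord_le => k; rewrite coordB.
(* The second term is the mean tested against grad J at x, evaluated by [mean_quad]; the last two
   sums are the errors of order eps. *)
have E : \sum_m grad J z 0 m * v m = D0 - \sum_a dotv (B a) (grad J (x t)) ^+ 2
    + \sum_m grad J (x t) 0 m * rem m
    + \sum_m (grad J z 0 m - grad J (x t) 0 m) * v m.
  rewrite -mean_quad.
  have -> : \sum_a \sum_b dotv (B a) (grad J (x t)) * (amp w a / w a) * amp w b *
      (dotv (B b) (grad J (x t)) * osc_mean w ph a b) =
      \sum_m grad J (x t) 0 m * mean m.
    rewrite /mean; under [RHS]eq_bigr do rewrite mulr_sumr.
    rewrite [RHS]exchange_big/=; apply: eq_bigr => a _.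
    under [RHS]eq_bigr do rewrite mulr_sumr.
    rewrite [RHS]exchange_big/=; apply: eq_bigr => b _.
    rewrite {1}/dotv !mulr_suml; apply: eq_bigr => m _; ring.
  rewrite /D0 /dotv -sumrB -!big_split/=; apply: eq_bigr => m _.
  by rewrite /v; ring.
rewrite E.
have D0' : D0 <= kappa * G ^+ 2 by exact: le_trans (ler_norm _) D0_le.
have ex := excitation (grad J (x t)); rewrite -/G in ex.
have r1 : \sum_m grad J (x t) 0 m * rem m <= N * (G * (eps * (CR * G))).
  apply: le_trans (ler_norm _) _.
  rewrite /N mulr_natl -[n in leRHS]card_ord -sumr_const; apply: norm_sum_le => k.
  by rewrite normrM; apply: ler_pM => //; [exact: coord_enorm|exact: rem_le].
have r2 : \sum_m (grad J z 0 m - grad J (x t) 0 m) * v m <=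
    N * (L * (N * (eps * (CZ * G))) * (CD * G)).
  apply: le_trans (ler_norm _) _.
  rewrite {1}/N mulr_natl -[n in leRHS]card_ord -sumr_const; apply: norm_sum_le => k.
  by rewrite normrM; apply: ler_pM.
have -> : - (gam - kappa - eps * (N * CR + N ^+ 2 * L * CZ * CD)) * G ^+ 2 =
  kappa * G ^+ 2 - gam * G ^+ 2 + N * (G * (eps * (CR * G))) +
  N * (L * (N * (eps * (CZ * G))) * (CD * G)) by ring.
by apply: lerD => //; apply: lerD => //; apply: lerB.
Qed.

End AlongSolution.

Lemma averaged_lyapunov (C1 : R) : 0 < C1 ->
  (forall x, enorm (grad J x) ^+ 2 <= C1 * (J x - J xstar)) -> kappa < gam ->
  exists2 epsS : R, 0 < epsS & forall eps : R, 0 < eps -> eps < epsS ->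
   (forall x tau, comparable_region x ->
      `|J (zmap eps x tau) - J x| <= (J x - J xstar) / 2) /\
   (forall (x : R -> V) (tau : R -> R) (t : R), is_derive t 1 tau (eps ^- 2) ->
      (forall m, is_derive t 1 (fun s => x s 0 m) (osc_field eps (x t) (tau t) m)) ->
      comparable_region (x t) ->
      exists2 D, is_derive t 1 (fun s => J (zmap eps (x s) (tau s))) D &
        D <= - ((gam - kappa) / 2 * enorm (grad J (x t)) ^+ 2)).
Proof.
move=> C10 HC1 kg.
set A := N * CR + N ^+ 2 * L * CZ * CD.
set A' := (N * CZ + L * (N * CZ) ^+ 2) * C1.
have A0 : 0 <= A.
  apply: addr_ge0 (mulr_ge0 N_ge0 CR_ge0) _.
  exact: mulr_ge0 (mulr_ge0 (mulr_ge0 (sqr_ge0 N) (ltW L_gt0)) CZ_ge0) CD_ge0.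
have A'0 : 0 <= A'.
  apply: mulr_ge0 (ltW C10); apply: addr_ge0 (mulr_ge0 N_ge0 CZ_ge0) _.
  exact: mulr_ge0 (ltW L_gt0) (sqr_ge0 _).
have gk : 0 < (gam - kappa) / 2 by lra.
(* The second bound leaves half of the margin [gam - kappa], the third makes the change of J at most
   half of the gap. [A + 1] and [A' + 1] are positive even if [A] or [A'] vanishes. *)
exists (Num.min 1 (Num.min ((gam - kappa) / 2 / (A + 1)) (1 / 2 / (A' + 1)))).
  by rewrite !lt_min ltr01 !divr_gt0//; lra.
move=> eps e0; rewrite !lt_min => /andP[e1 /andP[]].
rewrite !ltr_pdivlMr; try lra; move=> e2 e3; split.
  move=> x tau Hx; apply: le_trans (lyapunov_close tau e0 (ltW e1) Hx) _.
  have V0 : 0 <= J x - J xstar by rewrite subr_ge0.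
  have P0 : 0 <= N * CZ + L * (N * CZ) ^+ 2.
    apply: addr_ge0 (mulr_ge0 N_ge0 CZ_ge0) _.
    exact: mulr_ge0 (ltW L_gt0) (sqr_ge0 _).
  apply: (@le_trans _ _ (eps * (A' * (J x - J xstar)))).
    by rewrite ler_wpM2l ?(ltW e0)// /A' -[leRHS]mulrA ler_wpM2l.
  rewrite mulrA mulrC ler_wpM2l//; lra.
move=> x tau t Ht Hx Hr.
have [D HD DD] := lyapunov_derive e0 (ltW e1) Ht Hx Hr; exists D => //.
apply: le_trans DD _; rewrite mulNr lerN2 ler_wpM2r ?sqr_ge0// -/A; lra.
Qed.

End AveragedLyapunov.

(** * Ultimate bounds from decay outside a ball *)

Section Trajectory.
Variable R : realType.

Lemma continuous_clamp (V : normedModType R) (f : R -> V) :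
  {within [set s : R | 0 <= s], continuous f} ->
  continuous (fun s : R => f (Num.max s 0)).
Proof.
move=> fc s.
have m0 (u : R) : 0 <= Num.max u 0 by rewrite le_max lexx orbT.
have /subspace_continuousP := fc => /(_ _ (m0 s)) H.
apply: (@cvg_comp _ _ _ (fun u : R => Num.max u 0) f _
  (within [set u : R | 0 <= u] (nbhs (Num.max s 0)))) => //.
move=> A /= /nbhs_ballP[e /= e0 HA]; apply/nbhs_ballP; exists e => //= u su.
apply: HA => //; rewrite /ball/= in su *; apply: le_lt_trans su.
rewrite /Num.max; case: ltrP => ?; case: ltrP => ?; rewrite ?subrr ?normr0//.
- by rewrite sub0r normrN ger0_norm// ltr0_norm; lra.
- by rewrite subr0 ger0_norm// ger0_norm; lra.
Qed.

Lemma last_exit (rho : R -> R) (r0 t : R) : continuous rho -> 0 <= t -> r0 < rho t ->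
  (forall u, 0 <= u <= t -> r0 <= rho u) \/
  exists s, [/\ 0 <= s, s < t, rho s = r0 & forall u, s <= u <= t -> r0 <= rho u].
Proof.
move=> crho t0 rt.
have [[v /andP[v0 vt] vr]|H] := pselect (exists2 v, 0 <= v <= t & rho v < r0); last first.
  left=> u ut; rewrite leNgt; apply/negP => ur; apply: H; by exists u.
right.
(* The last exit time is the supremum of the times spent strictly inside; continuity gives
   [rho s = r0] there. *)
pose E := [set u | 0 <= u <= t /\ rho u < r0].
have Ev : E v by split=> //; rewrite v0.
have supE : has_sup E by split; [exists v | exists t => u [/andP[]]].
pose s := sup E.
have vs : v <= s by apply: ub_le_sup => //; exact: supE.2.
have st : s <= t by apply: ge_sup; [exists v | move=> u [/andP[]]].
have above u : s < u -> u <= t -> r0 <= rho u.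
  move=> su ut; rewrite leNgt; apply/negP => ur.
  have : u <= s by apply: ub_le_sup; [exact: supE.2|split=> //; rewrite ut andbT; lra].
  lra.
have rs : rho s <= r0.
  rewrite leNgt; apply/negP => rs.
  have /nbhs_ballP[e /= e0 He] : \forall u \near s, r0 < rho u.
    exact: (cvgr_gt _ (crho s)).
  have [u [/andP[u0 ut] ur] su] := sup_adherent e0 supE.
  have us : u <= s by apply: ub_le_sup; [exact: supE.2|split=> //; rewrite u0].
  have := He u; rewrite /ball/= ger0_norm ?subr_ge0// -/s in su *.
  by move=> /(_ ltac:(lra)); lra.
have st' : s < t by rewrite lt_neqAle st andbT; apply/eqP => E'; move: rs; rewrite E'; lra.
have rs' : r0 <= rho s.
  rewrite leNgt; apply/negP => rs'.
  have /nbhs_ballP[e /= e0 He] : \forall u \near s, rho u < r0.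
    exact: (cvgr_lt _ (crho s)).
  pose u := Num.min (s + e / 2) t.
  have su : s < u by rewrite lt_min st' andbT; lra.
  have ut : u <= t by rewrite ge_min lexx orbT.
  have ue : u <= s + e / 2 by rewrite ge_min lexx.
  have := above u su ut.
  have := He u; rewrite /ball/= ltr0_norm ?subr_lt0//.
  by move=> /(_ ltac:(lra)); lra.
exists s; split=> //; first exact: le_trans vs.
  by apply/eqP; rewrite eq_le rs rs'.
move=> u /andP[]; rewrite le_eqVlt => /orP[/eqP<-//|su ut]; exact: above.
Qed.

Lemma decay_interval (U dU : R -> R) (s t m : R) : s <= t ->
  (forall u, s <= u <= t -> is_derive u 1 U (dU u)) ->
  (forall u, s <= u <= t -> dU u <= - m) -> U t <= U s - m * (t - s).
Proof.
move=> st HU Hm.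
have cU : {within `[s, t], continuous U}.
  apply: derivable_within_continuous => u; rewrite in_itv/= => /HU[]//.
have HU' u : u \in `]s, t[%R -> is_derive u 1 U (dU u).
  by rewrite in_itv/= => /andP[su ut]; apply: HU; rewrite !ltW.
have [c + E] := MVT_segment st HU' cU.
rewrite in_itv/= => /Hm H; have : 0 <= t - s by lra.
nra.
Qed.

(** To be read as: [rho] the distance to the minimizer, [W] the gap J - J xstar, [U] the same gap at
    the corrected point z. *)
Variables (alpha rho W U dU : R -> R) (C1 k r0 : R).
Hypothesis alphaK : classK alpha.
Hypotheses (C1_gt0 : 0 < C1) (k_gt0 : 0 < k).
Hypothesis rho_ge0 : forall u, 0 <= rho u.
Hypothesis rho_cont : continuous rho.
Hypothesis W_cont : continuous W.
Hypothesis W_le : forall u, W u <= C1 * rho u ^+ 2.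
Hypothesis gain_le_W : forall u, gain alpha (rho u) <= C1 * W u.
Hypothesis U_W : forall u, 0 < u -> r0 <= rho u -> W u / 2 <= U u <= 3 / 2 * W u.
Hypothesis dU_U : forall u, 0 < u -> r0 <= rho u -> is_derive u 1 U (dU u).
Hypothesis dU_le : forall u, 0 < u -> r0 <= rho u -> dU u <= - (k * gain alpha (rho u)).

(** On a stretch outside the ball ending at [t], [U] decreases, so [W t <= 3 * W u] at earlier [u]
    and [gain alpha (rho t) <= 3 * C1 ^+ 2 * rho u ^+ 2]. The square root is thus a lower bound for
    [rho u], and [rate t] one for the decay. *)
Let rate (t : R) : R := k * gain alpha (Num.sqrt (gain alpha (rho t) / (4 * C1 ^+ 2))).

(* [U] need not be continuous at [s = 0]: the estimate is proved on [s', t] and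
   extended to [s] by continuity of [W]. *)
Let segment_estimate (s t : R) : 0 <= s -> s < t ->
  (forall u, s <= u <= t -> r0 <= rho u) ->
  W t / 2 <= 3 / 2 * W s - rate t * (t - s).
Proof.
move=> s0 st Hr.
have g0 u : 0 <= gain alpha u by exact: gain_ge0.
have inner s' : s < s' -> s' <= t -> W t / 2 <= 3 / 2 * W s' - rate t * (t - s').
  move=> ss' s't.
  have pos u : s' <= u <= t -> 0 < u /\ r0 <= rho u.
    by move=> /andP[su ut]; split; [lra | apply: Hr; rewrite ut andbT; lra].
  have dec u : s' <= u <= t -> U t <= U u.
    move=> /andP[su ut].
    have := @decay_interval U dU u t 0 ut; rewrite mul0r subr0; apply.
      by move=> v /andP[uv vt]; have [|? ?] := pos v; [rewrite vt andbT; lra | exact: dU_U].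
    move=> v /andP[uv vt]; have [|v0 vr] := pos v; first by rewrite vt andbT; lra.
    rewrite oppr0; apply: le_trans (dU_le v0 vr) _; rewrite oppr_le0 mulr_ge0// ltW//.
  have rate_le u : s' <= u <= t -> dU u <= - rate t.
    move=> ut; have [u0 ur] := pos u ut; apply: le_trans (dU_le u0 ur) _.
    rewrite lerN2 ler_wpM2l ?(ltW k_gt0)//; apply: gain_le; rewrite ?sqrtr_ge0//.
    rewrite -[rho u]ger0_norm// -sqrtr_sqr ler_wsqrtr// ler_pdivrMr ?mulr_gt0 ?exprn_gt0//.
    have := dec u ut; have /andP[_ U1] := U_W u0 ur.
    have [t0 tr] : 0 < t /\ r0 <= rho t by apply: pos; rewrite s't lexx.
    have /andP[U2 _] := U_W t0 tr.
    move=> d1; have h1 : W t <= 3 * W u by lra.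
    have h2 := W_le u.
    have h3 : W t <= 3 * (C1 * rho u ^+ 2) by lra.
    have h4 := ler_wpM2l (ltW C1_gt0) h3.
    have h5 := gain_le_W t.
    have h6 : 0 <= C1 ^+ 2 * rho u ^+ 2 by rewrite mulr_ge0 ?sqr_ge0.
    apply: le_trans h5 _; apply: le_trans h4 _.
    have -> : C1 * (3 * (C1 * rho u ^+ 2)) = 3 * (C1 ^+ 2 * rho u ^+ 2) by ring.
    have -> : rho u ^+ 2 * (4 * C1 ^+ 2) = 4 * (C1 ^+ 2 * rho u ^+ 2) by ring.
    lra.
  have H := decay_interval s't (fun u ut => let: conj u0 ur := pos u ut in dU_U u0 ur) rate_le.
  have [t0 tr] : 0 < t /\ r0 <= rho t by apply: pos; rewrite s't lexx.
  have [s0' sr] : 0 < s' /\ r0 <= rho s' by apply: pos; rewrite s't lexx.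
  have /andP[U1 _] := U_W t0 tr; have /andP[_ U2] := U_W s0' sr.
  lra.
apply/ler_addgt0Pr => e e0.
have rate0 : 0 <= rate t by rewrite mulr_ge0// ltW.
have e4 : 0 < e / 4 by lra.
have /nbhs_ballP[d /= d0 Hd] : \forall u \near s, W u < W s + e / 4.
  have We : W s < W s + e / 4 by lra.
  exact (@cvgr_lt _ _ (nbhs s) _ W (W s) (@W_cont s) _ We).
(* The start moves by [h]: small enough for [W] to grow by less than [e / 4], for [s + h] to stay
   before [t], and for the lost decay to be at most [e / 4]. *)
pose h := Num.min (d / 2) (Num.min (t - s) (e / (4 * (rate t + 1)))).
have r1 : 0 < 4 * (rate t + 1) by lra.
have h0 : 0 < h by rewrite !lt_min divr_gt0// subr_gt0 st divr_gt0.
have [h1 h2 h3] : [/\ h <= d / 2, h <= t - s & h <= e / (4 * (rate t + 1))].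
  by rewrite /h !ge_min !lexx !orbT.
have Ws : W (s + h) < W s + e / 4.
  by apply: Hd; rewrite /ball/= opprD addrA subrr sub0r normrN gtr0_norm//; lra.
have := inner (s + h) ltac:(lra) ltac:(lra).
move: h3; rewrite ler_pdivlMr// => h3.
have : rate t * h <= e / 4 by nra.
nra.
Qed.

(** Each summand settles one case: [beta] a trajectory outside the ball since time 0, [Delta] one
    that has left it since, when the estimate restarts from [rho s = r0] at the last exit. *)
Lemma trajectory_bound (beta : R -> R -> R) (Delta t : R) :
  (forall s t r : R, 0 <= t -> 0 <= r -> gain alpha r <= 3 * C1 ^+ 2 * s ^+ 2 ->
    t * (k * gain alpha (Num.sqrt (gain alpha r / (4 * C1 ^+ 2)))) <= 3 / 2 * C1 * s ^+ 2 ->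
    r <= beta s t) ->
  0 <= r0 -> r0 <= Delta -> 3 * C1 ^+ 2 * r0 ^+ 2 <= gain alpha Delta -> 0 <= t ->
  rho t <= beta (rho 0) t + Delta.
Proof.
move=> Hbeta r00 rD gD t0.
(* [r = 0] satisfies both premises on [beta]. *)
have beta0 : 0 <= beta (rho 0) t.
  apply: Hbeta => //; rewrite gain0 ?mul0r ?sqrtr0 ?gain0 ?mulr0.
    by rewrite -mulrA; have := mulr_ge0 (sqr_ge0 C1) (sqr_ge0 (rho 0)); lra.
  by rewrite -mulrA; have := mulr_ge0 (ltW C1_gt0) (sqr_ge0 (rho 0)); lra.
have [|rt] := leP (rho t) r0; first by lra.
have W0 u : 0 <= W u by have := gain_le_W u; have := gain_ge0 alpha (rho u) => g h;
  rewrite -(pmulr_rge0 _ C1_gt0) (le_trans g).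
have rate0 : 0 <= rate t by rewrite mulr_ge0 ?gain_ge0// ltW.
have H s : 0 <= s -> s < t -> (forall u, s <= u <= t -> r0 <= rho u) ->
   gain alpha (rho t) <= 3 * C1 ^+ 2 * rho s ^+ 2 /\
   (t - s) * rate t <= 3 / 2 * C1 * rho s ^+ 2.
  move=> s0 st Hr; have E := segment_estimate s0 st Hr.
  have := W_le s; have := gain_le_W t; have Wt := W0 t.
  have ts : 0 <= rate t * (t - s) by rewrite mulr_ge0// subr_ge0 ltW.
  move=> g1 g2; split; last by lra.
  have : W t <= 3 * (C1 * rho s ^+ 2) by lra.
  move=> /(ler_wpM2l (ltW C1_gt0)) g3.
  apply: le_trans g1 _; apply: le_trans g3 _.
  by rewrite le_eqVlt; apply/orP; left; apply/eqP; ring.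
have [Hr|[s [s0 st sr Hr]]] := last_exit rho_cont t0 rt.
  suff : rho t <= beta (rho 0) t by lra.
  apply: Hbeta => //.
    move: t0; rewrite le_eqVlt => /orP[/eqP<-|tp]; last by have [] := H 0 (lexx _) tp Hr.
    have := W_le 0; have := gain_le_W 0 => g1 /(ler_wpM2l (ltW C1_gt0)) g2.
    apply: le_trans g1 _; apply: le_trans g2 _.
    have : 0 <= C1 ^+ 2 * rho 0 ^+ 2 by rewrite mulr_ge0 ?sqr_ge0.
    have -> : C1 * (C1 * rho 0 ^+ 2) = C1 ^+ 2 * rho 0 ^+ 2 by ring.
    by rewrite -mulrA; lra.
  move: t0; rewrite le_eqVlt => /orP[/eqP<-|tp].
    by rewrite mul0r -mulrA; have := mulr_ge0 (ltW C1_gt0) (sqr_ge0 (rho 0)); lra.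
  by have [_] := H 0 (lexx _) tp Hr; rewrite subr0.
have [g _] := H s s0 st Hr; rewrite sr in g.
suff : rho t <= Delta by lra.
rewrite leNgt; apply/negP => Dt.
have := gain_lt alphaK (le_trans r00 rD) Dt; lra.
Qed.

End Trajectory.

(** * Continuation of solutions *)

Section Extension.
Variables (R : realType) (n : nat).
Local Notation V := 'rV[R]_n.

Lemma is_derive_rowP (x : R -> V) (t : R) (v : V) :
  is_derive t 1 x v <-> forall m, is_derive t 1 (fun s => x s 0 m) (v 0 m).
Proof.
split=> [[dx xv] m|H].
  have dm := (derivable_mxP x t 1).1 dx 0 m.
  constructor => //; by rewrite -xv derive_mx// mxE.
have dx : derivable x t 1.
  by apply/derivable_mxP => i j; rewrite ord1; case: (H j).
constructor => //; apply/rowP => m; rewrite derive_mx// mxE.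
by have [_ <-] := H m.
Qed.

Lemma is_derive_continuous (h : R -> R) (t d : R) : is_derive t 1 h d ->
  {for t, continuous h}.
Proof. by case=> dh _; apply/differentiable_continuous/derivable1_diffP. Qed.

(** The mean value theorem on either side of [t0] turns the limit of the derivatives into the
    derivative at [t0]. This gives the equation at the point where two solutions are glued. *)
Lemma is_derive_junction (h g : R -> R) (t0 v : R) : {for t0, continuous h} ->
  (forall e : R, 0 < e -> exists2 d : R, 0 < d & forall u, u != t0 -> `|u - t0| < d ->
     is_derive u 1 h (g u) /\ `|g u - v| <= e) ->
  is_derive t0 1 h v.
Proof.
move=> ch H; apply: is_derive_eps => e e0; have [d d0 Hd] := H e e0.
exists d => // u ud.
have mvt a b : a < b -> (forall w, a <= w <= b -> `|w - t0| < d) ->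
    (forall w, a < w < b -> w != t0) -> `|h b - h a - (b - a) * v| <= e * (b - a).
  move=> ab near_t0 neq_t0.
  have ba : 0 < b - a by rewrite subr_gt0.
  have dh w : w \in `]a, b[%R -> is_derive w 1 h (g w).
    rewrite in_itv/= => wab; have [wa wb] := andP wab.
    by apply: (Hd w (neq_t0 w wab) (near_t0 w _)).1; rewrite !ltW.
  have cab : {within `[a, b], continuous h}.
    apply: continuous_in_subspaceT => w; rewrite inE/= in_itv/= => wab.
    have [->//|wt] := eqVneq w t0.
    exact: is_derive_continuous (Hd w wt (near_t0 w wab)).1.
  have [c + ->] := MVT ab dh cab.
  rewrite in_itv/= => cab'; have [ca cb] := andP cab'.
  have -> : g c * (b - a) - (b - a) * v = (g c - v) * (b - a) by ring.
  rewrite normrM (gtr0_norm ba) ler_wpM2r ?(ltW ba)//.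
  by apply: (Hd c (neq_t0 c cab') (near_t0 c _)).2; rewrite !ltW.
move: ud; rewrite ltr_norml => /andP[u1 u2].
have [tu|ut|->] := ltrgtP t0 u; last by rewrite !subrr scale0r subr0 normr0 mulr0.
  apply: mvt => // w /andP[w1 w2].
    by rewrite ltr_norml; apply/andP; split; lra.
  by rewrite gt_eqF.
rewrite -normrN.
have -> : - (h u - h t0 - (u - t0) *: v) = h t0 - h u - (t0 - u) * v.
  by rewrite /GRing.scale/=; ring.
apply: mvt => // w /andP[w1 w2]; last by rewrite lt_eqF.
by rewrite ltr_norml; apply/andP; split; lra.
Qed.

Variables (F : R -> V -> V) (K : R).
Hypothesis K_ge0 : 0 <= K.
Hypothesis F_growth : forall t x, `|F t x| <= K * (1 + `|x|).
Hypothesis F_cont : continuous (fun p : R * V => F p.1 p.2).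

Variables (x : R -> V) (T : R).
Hypothesis T_gt0 : 0 < T.
Hypothesis x_cont : {within [set t : R | 0 <= t < T], continuous x}.
Hypothesis x_deriv : forall t : R, 0 < t < T -> is_derive t 1 x (F t (x t)).

(** Only the behaviour near [T] matters; starting at [T / 2] avoids 0, where [x] is merely
    continuous. *)
Let mid : R := T / 2.
Let mid_gt0 : 0 < mid. Proof. by rewrite divr_gt0. Qed.
Let mid_lt : mid < T. Proof. by rewrite /mid; have := T_gt0; lra. Qed.

Let F_coord t y m : `|F t y 0 m| <= K * (1 + `|y|).
Proof. exact: le_trans (normr_coord _ _) (F_growth _ _). Qed.

(** Gronwall in differential form: with [W = 1 + |x|^2] and [C = 4 n K], the linear growth of [F]
    makes [W t * expR (- C * t)] nonincreasing. *)
Let solution_bounded : exists2 M, 0 <= M & forall t, mid <= t < T -> `|x t| <= M.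
Proof.
pose W t := 1 + \sum_m x t 0 m * x t 0 m.
pose C := 4 * n%:R * K.
have C0 : 0 <= C by rewrite !mulr_ge0.
have sq u : `|x u| ^+ 2 <= \sum_m x u 0 m * x u 0 m.
  apply: (@le_trans _ _ (enorm (x u) ^+ 2)).
    by rewrite lerXn2r// ?nnegrE ?enorm_ge0// normr_le_enorm.
  by rewrite -dotvv.
have W0 u : 1 <= W u by rewrite lerDl sumr_ge0// => m _; rewrite -expr2 sqr_ge0.
have dW u : 0 < u < T -> is_derive u 1 (fun s => W s * expR (- C * s))
    (W u * (expR (- C * u) * - C) + expR (- C * u) *
      (0 + \sum_m (x u 0 m * F u (x u) 0 m + x u 0 m * F u (x u) 0 m))).
  move=> uT; have /is_derive_rowP H := x_deriv uT.
  have H1 := is_derive_add (is_derive_cst (1 : R) u 1)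
     (is_derive_sum_fin (fun m => is_derive_mul (H m) (H m))).
  have H2 : is_derive u 1 (fun s => expR (- C * s)) (expR (- C * u) * - C).
    have := is_derive1_comp (is_derive_expR (- C * u)) (is_derive_cmul (- C) (is_derive_id u 1)).
    by rewrite mulr1.
  exact: is_derive_mul H1 H2.
have decr t : mid <= t < T -> W t * expR (- C * t) <= W mid * expR (- C * mid).
  move=> /andP[mt tT].
  have uT u : mid <= u <= t -> 0 < u < T.
    by move=> /andP[mu ut]; apply/andP; split; have := mid_gt0; lra.
  have := @decay_interval _ (fun s => W s * expR (- C * s)) _ mid t 0 mt (fun u ut => dW u (uT u ut)).
  rewrite mul0r subr0 oppr0; apply => u ut.
  have E0 : 0 < expR (- C * u) by exact: expR_gt0.
  have -> : W u * (expR (- C * u) * - C) + expR (- C * u) * (0 +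
     \sum_m (x u 0 m * F u (x u) 0 m + x u 0 m * F u (x u) 0 m)) =
     expR (- C * u) * (\sum_m (x u 0 m * F u (x u) 0 m + x u 0 m * F u (x u) 0 m) - C * W u).
    by ring.
  rewrite pmulr_rle0// subr_le0.
  apply: (@le_trans _ _ (\sum_(m < n) 2 * (`|x u| * (K * (1 + `|x u|))))).
    apply: ler_sum => m _; rewrite -mulr2n -[leLHS]mulr_natl ler_wpM2l//.
    apply: le_trans (ler_norm _) _; rewrite normrM; apply: ler_pM => //; exact: normr_coord.
  rewrite sumr_const card_ord -[leLHS]mulr_natl /C.
  have -> : n%:R * (2 * (`|x u| * (K * (1 + `|x u|)))) = n%:R * (K * (2 * (`|x u| * (1 + `|x u|)))) by ring.
  have -> : 4 * n%:R * K * W u = n%:R * (K * (4 * W u)) by ring.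
  rewrite ler_wpM2l// ler_wpM2l//.
  have s1 := sq u; rewrite /W; set q := \sum_m _ in s1 *; set z := `|x u| in s1 *.
  have := sqr_ge0 (z - 1); rewrite expr2; nra.
pose M := W mid * expR (- C * mid) * expR (C * T).
have M0 : 0 <= M by rewrite !mulr_ge0 ?expR_ge0// (le_trans ler01).
have Wt t : mid <= t < T -> W t <= M.
  move=> tT; have := decr t tT; have /andP[_ tT'] := tT.
  rewrite -(ler_pM2r (expR_gt0 (C * t))) -[leLHS]mulrA -expRD mulNr addNr expR0 mulr1 => H.
  apply: le_trans H _; rewrite ler_wpM2l ?mulr_ge0 ?expR_ge0// ?(le_trans ler01)//.
  by rewrite ler_expR ler_wpM2l// ltW.
exists M => // t tT.
have := sq t; have := Wt t tT; rewrite /W; set q := \sum_m _; have z0 : 0 <= `|x t| by [].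
set z := `|x t| in z0 * => h1 h2.
have [z1|z1] := leP z 1; last by nra.
have q0 : 0 <= q by apply: le_trans h2; exact: sqr_ge0.
lra.
Qed.

Let solution_lipschitz : exists2 C, 0 <= C &
  forall s t m, mid <= s -> s <= t -> t < T -> `|x t 0 m - x s 0 m| <= C * (t - s).
Proof.
have [M M0 HM] := solution_bounded; exists (K * (1 + M)); first by rewrite mulr_ge0// addr_ge0.
move=> s t m ms st tT.
have dx u : s <= u <= t -> is_derive u 1 (fun s => x s 0 m) (F u (x u) 0 m).
  move=> /andP[su ut]; have /is_derive_rowP := @x_deriv u ltac:(have := mid_gt0; lra).
  exact.
have cx : {within `[s, t], continuous (fun s => x s 0 m)}.
  by apply: derivable_within_continuous => u; rewrite in_itv/= => /dx[].
have dx' u : u \in `]s, t[%R -> is_derive u 1 (fun s => x s 0 m) (F u (x u) 0 m).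
  by rewrite in_itv/= => /andP[su ut]; apply: dx; rewrite !ltW.
have [c + ->] := MVT_segment st dx' cx.
rewrite in_itv/= => /andP[sc ct]; rewrite normrM (ger0_norm (x := t - s)) ?subr_ge0//.
rewrite ler_wpM2r ?subr_ge0//; apply: le_trans (F_coord _ _ _) _.
by rewrite ler_wpM2l// lerD2l HM//; apply/andP; split; lra.
Qed.

Let left_limit : exists xl : V, forall m, x t 0 m @[t --> T^'-] --> xl 0 m.
Proof.
have [C C0 HC] := solution_lipschitz.
have cm m : cvg (x t 0 m @[t --> T^'-]).
  apply: cauchy_cvg; apply: cauchy_exP => e e0.
  have C1 : 0 < C + 1 by lra.
  pose s := Num.max mid (T - e / (C + 1)).
  have [ms es] : mid <= s /\ T - e / (C + 1) <= s by rewrite /s !le_max !lexx orbT.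
  have sT : s < T by rewrite gt_max mid_lt ltrBlDr ltrDl divr_gt0.
  exists (x s 0 m).
  suff : \forall t \near T^'-, `|x s 0 m - x t 0 m| < e by [].
  near=> t.
  have st : s < t by near: t; exact: nbhs_left_gt.
  have tT : t < T by near: t; exact: nbhs_left_lt.
  rewrite distrC; apply: le_lt_trans (HC s t m ms (ltW st) tT) _.
  have : T - s <= e / (C + 1) by lra.
  rewrite ler_pdivlMr// => h; have : 0 < t - s by lra.
  nra.
by exists (\row_m lim (x t 0 m @[t --> T^'-])) => m; rewrite mxE; exact: cm.
Unshelve. all: by end_near. Qed.

(** Bounded velocity gives a left limit at [T], and a Peano solution for the shifted field, global
    by linear growth, is attached there. *)
Lemma solution_extension : exists z : R -> V,
  [/\ forall t : R, t < T -> z t = x t, {within [set t : R | 0 <= t], continuous z} &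
   forall t : R, 0 < t -> is_derive t 1 z (F t (z t))].
Proof.
have [xl Hxl] := left_limit.
have shift_growth (t : R) (y : V) : `|F (T + t) y| <= K * (1 + `|y|) by exact: F_growth.
have shift_cont : continuous (fun p : R * V => F (T + p.1) p.2).
  move=> p; apply: (@continuous2_cvg _ _ _ _ (nbhs p) _ (fun p : R * V => T + p.1) snd F).
  - exact: (@F_cont (T + p.1, p.2)).
  - by apply: cvgD; [exact: cvg_cst | exact: cvg_fst].
  - exact: cvg_snd.
have [y [y0 yc dy]] := peano xl K_ge0 shift_growth shift_cont.
pose z (t : R) := if t < T then x t else y (t - T).
have zl (t : R) : t < T -> z t = x t by rewrite /z => ->.
have zr (t : R) : T <= t -> z t = y (t - T) by rewrite /z ltNge => ->.
have zT : z T = xl by rewrite zr// subrr.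
have zcT : {for T, continuous z}.
  apply/left_right_continuousP; split; rewrite zT.
    apply/cvgrPdist_le => e e0.
    have He : \forall t \near T^'-, forall m, `|xl 0 m - x t 0 m| <= e.
      apply: (@filter_forall R 'I_n (fun m t => `|xl 0 m - x t 0 m| <= e) (T^'-) _) => m.
      by have /cvgrPdist_le/(_ e e0) := Hxl m.
    suff : \forall t \near T^'-, `|xl - z t| <= e by [].
    near=> t.
    have tT : t < T by near: t; exact: nbhs_left_lt.
    have Ht : forall m, `|xl 0 m - x t 0 m| <= e by near: t.
    rewrite zl//; apply: normr_row_le => [|m]; first exact: ltW.
    by rewrite coordB.
  have yz : {near T^'+, (fun t => y (t - T)) =1 z}.
    by near=> t; rewrite zr//; near: t; exact: nbhs_right_ge.
  apply: cvg_trans (near_eq_cvg yz) _.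
  apply: cvg_at_right_filter.
  rewrite -y0 -[X in y X](subrr T).
  apply: (@continuous_comp _ _ _ (fun t : R => t - T) y); last exact: yc.
  by apply: cvgB; [exact: cvg_id | exact: cvg_cst].
have dz (t : R) : 0 < t -> t != T -> is_derive t 1 z (F t (z t)).
  move=> t0 tnT; have [tT|Tt] := ltP t T.
    rewrite zl//; apply: (near_eq_is_derive (f := x)).
      by near=> s; rewrite zl//; near: s; exact: lt_nbhsl.
    by apply: x_deriv; rewrite t0.
  have {}Tt : T < t by rewrite lt_neqAle eq_sym tnT.
  rewrite zr ?(ltW Tt)//; apply: (near_eq_is_derive (f := fun s => y (s - T))).
    by near=> s; rewrite zr//; apply/ltW; near: s; exact: lt_nbhsr.
  have Tt0 : 0 < t - T by rewrite subr_gt0.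
  have /is_derive_rowP Hy := dy _ Tt0; apply/is_derive_rowP => m.
  have Hs : is_derive t 1 (fun s : R => s - T) 1.
    by have := is_derive_sub (is_derive_id t 1) (is_derive_cst T t 1); rewrite subr0.
  have := @is_derive1_comp R (fun s => y s 0 m) (fun s => s - T) t _ 1 (Hy m) Hs.
  rewrite mulr1.
  by rewrite (_ : T + (t - T) = t)//; ring.
have cz (t : R) : 0 < t -> {for t, continuous z}.
  move=> t0; have [->//|tT] := eqVneq t T.
  by apply/differentiable_continuous/derivable1_diffP; case: (dz t t0 tT).
exists z; split=> //.
- apply/subspace_continuousP => t; rewrite /= le_eqVlt => /orP[/eqP<-|t0]; last first.
    exact: cvg_within_filter (cz t t0).
  have z0 : z 0 = x 0 by rewrite zl.
  rewrite /from_subspace z0.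
  have /subspace_continuousP /(_ 0) := x_cont => /(_ _) H.
  have {}H : x @ within [set t | 0 <= t < T] (nbhs 0) --> x 0 by apply: H; rewrite /= lexx.
  move=> A xA; have := H A xA; rewrite /= => {}H.
  have N : \forall s \near (0 : R), s < T by exact: lt_nbhsl.
  by apply: filterS2 N H => s sT Hs s0 /=; rewrite zl//; apply: Hs; rewrite /= s0 sT.
- move=> t t0; have [->|tT] := eqVneq t T; last exact: dz.
  apply/is_derive_rowP => m.
  apply: (@is_derive_junction _ (fun u => F u (z u) 0 m)).
    apply: (@continuous_comp _ _ _ z (fun v : V => v 0 m)); first exact: zcT.
    exact: coord_continuous.
  move=> e e0.
  have /cvgrPdist_le/(_ e e0)/nbhs_ballP[d /= d0 Hd] : F u (z u) 0 m @[u --> T] --> F T (z T) 0 m.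
    apply: (@continuous_comp _ _ _ (fun u => F u (z u)) (fun v : V => v 0 m)); last exact: coord_continuous.
    apply: (@continuous2_cvg _ _ _ _ (nbhs T) _ id z F); [exact: (@F_cont (T, z T))|exact: cvg_id|exact: zcT].
  exists (Num.min d T); first by rewrite lt_min d0.
  move=> u uT; rewrite lt_min => /andP[ud uT'].
  have u0 : 0 < u by move: uT'; rewrite ltr_norml => /andP[]; lra.
  split; first by have /is_derive_rowP := dz u u0 uT; exact.
  by rewrite distrC; apply: Hd; rewrite /ball/= distrC.
Unshelve. all: by end_near. Qed.

End Extension.

(** * The extremum seeking system *)

Section OscillatingInputs.
Variable R : realType.

Lemma continuous_u (g : R -> R) (w : R) : continuous g -> (forall s, `|g s| <= 1) ->
  continuous (fun p : R * R =>
    if 0 < p.1 then Num.sqrt (2 * w * p.1) * g (ln p.1 + w * p.2) else 0).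
Proof.
move=> cg g1 [j s].
have [j0|j0|j0] := ltrgtP j 0.
- apply: (@cvg_near_cst _ _ _ _ (nbhs (j, s))).
  have [W W1 W2] : exists2 d, 0 < d & j + d < 0 by exists (- j / 2); lra.
  apply/(@nbhs_ballP _ _ (j, s)); exists W => //= -[j' s'] [/= + _].
  by rewrite /ball/= ltr_norml => /andP[? ?]; rewrite !ifF//; apply/negbTE; rewrite -leNgt; lra.
- have H : {near (j, s), (fun p : R * R => Num.sqrt (2 * w * p.1) * g (ln p.1 + w * p.2)) =1
    (fun p : R * R => if 0 < p.1 then Num.sqrt (2 * w * p.1) * g (ln p.1 + w * p.2) else 0)}.
    apply/(@nbhs_ballP _ _ (j, s)); exists j => //= -[j' s'] [/= + _].
    by rewrite /ball/= ltr_norml => /andP[? ?]; rewrite ifT//; lra.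
  rewrite /continuous_at [X in _ --> X]/= j0; apply: cvg_trans (near_eq_cvg H) _.
  have c1 : (fun p : R * R => p.1) @ nbhs (j, s) --> j by exact: cvg_fst.
  have c2 : (fun p : R * R => p.2) @ nbhs (j, s) --> s by exact: cvg_snd.
  apply: cvgM.
    apply: (@cvg_comp _ _ _ (fun p : R * R => 2 * w * p.1) Num.sqrt _ (nbhs (2 * w * j)));
      last exact: sqrt_continuous.
    by apply: cvgM => //; exact: cvg_cst.
  apply: (@cvg_comp _ _ _ (fun p : R * R => ln p.1 + w * p.2) g _ (nbhs (ln j + w * s)));
    last exact: cg.
  apply: cvgD; last by apply: cvgM => //; exact: cvg_cst.
  apply: (@cvg_comp _ _ _ (fun p : R * R => p.1) (@ln R) _ (nbhs j)) => //.
  exact: continuous_ln.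
- rewrite j0 /continuous_at [X in _ --> X]/= ltxx; apply/(@cvgr0Pnorm_lt _ _ _ (nbhs ((0 : R), s))) => e e0.
  have w1 : 0 < 2 * `|w| + 1 by rewrite ltr_wpDl// mulr_ge0.
  apply/(@nbhs_ballP _ _ (0, s)); exists (e ^+ 2 / (2 * `|w| + 1)); first by rewrite /= divr_gt0// exprn_gt0.
  move=> [j' s'] [/= + _]; rewrite /ball/= sub0r normrN => jj.
  case: ifPn => [j'0|_]; last by rewrite normr0.
  rewrite normrM; apply: (@le_lt_trans _ _ (Num.sqrt (2 * w * j'))).
    by rewrite ger0_norm ?sqrtr_ge0// ler_piMr ?sqrtr_ge0.
  rewrite -[e]ger0_norm ?(ltW e0)// -sqrtr_sqr ltr_sqrt ?exprn_gt0//.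
  move: jj; rewrite gtr0_norm// ltr_pdivlMr// => jj.
  have := ler_norm w; nra.
Qed.

End OscillatingInputs.

Section ESSystem.
Variables (R : realType) (n r : nat) (b : 'I_r -> 'I_2 -> 'rV[R]_n).
Variables (omega : 'I_r -> rat) (b0 : 'rV[R]_n -> 'rV[R]_n) (J : 'rV[R]_n -> R).
Variables (xstar : 'rV[R]_n) (L L0 kappa : R).
Hypothesis omega_gt0 : forall i, 0 < omega i.
Hypothesis omega_inj : injective omega.
Hypothesis JC2 : C2 J.
Hypothesis L_gt0 : 0 < L.
Hypothesis JL : forall x, hess_norm J x <= L.
Hypothesis Jmin : forall x, J xstar <= J x.
Hypothesis grad0 : grad J xstar = 0.
Hypothesis kappa_ge0 : 0 <= kappa.
Hypothesis b0_le : forall x, enorm (b0 x) <= kappa * enorm (grad J x).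
Hypothesis L0_gt0 : 0 < L0.
Hypothesis b0_lip : forall x y, enorm (b0 x - b0 y) <= L0 * enorm (x - y).
Local Notation V := 'rV[R]_n.

(* Both inputs of a pair are written as cosines, [sin A = cos (A - pi / 2)]. *)
Definition es_vec (a : 'I_r * 'I_2) : V := b a.1 a.2.
Definition es_freq (a : 'I_r * 'I_2) : R := ratr (omega a.1).
Definition es_shift (a : 'I_r * 'I_2) : R := if a.2 == ord0 then 0 else pi / 2.

Lemma es_freq_gt0 a : 0 < es_freq a.
Proof. by rewrite ltr0q. Qed.

Lemma sum_ord2 (W : nmodType) (F : 'I_2 -> W) : \sum_j F j = F ord0 + F ord_max.
Proof.
by rewrite big_ord_recl big_ord_recl big_ord0 addr0; congr (_ + F _); apply: val_inj.
Qed.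

Lemma sum_pair2 (W : nmodType) (F : 'I_r * 'I_2 -> W) :
  \sum_a F a = \sum_i (F (i, ord0) + F (i, ord_max)).
Proof.
rewrite (eq_bigr (fun a => F (a.1, a.2))); last by case.
rewrite -(pair_bigA _ (fun i j => F (i, j)))/=.
by apply: eq_bigr => i _; rewrite sum_ord2.
Qed.

Lemma amp_sq a : amp es_freq a * amp es_freq a / es_freq a = 2.
Proof.
have w0 := es_freq_gt0 a.
rewrite -expr2 sqr_sqrtr; last by rewrite mulr_ge0// ltW.
by rewrite mulfK// gt_eqF.
Qed.

(** Distinct frequencies do not resonate. Within a pair the matrix of [osc_mean] is half the
    identity plus a skew part with entries 1/4 and -1/4, and the factor [amp ^+ 2 / es_freq = 2]
    turns the half into 1. *)
Lemma es_mean_quad (d : 'I_r * 'I_2 -> R) :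
  \sum_a \sum_c d a * (amp es_freq a / es_freq a) * amp es_freq c *
     (d c * osc_mean es_freq es_shift a c) = \sum_a d a ^+ 2.
Proof.
have other a c : a.1 != c.1 -> osc_mean es_freq es_shift a c = 0.
  move=> ac; rewrite /osc_mean /cc_mean.
  have -> : (es_freq a == es_freq c) = false.
    by apply/negbTE; rewrite (inj_eq (fmorph_inj _)) (inj_eq omega_inj).
  by rewrite mul0r addr0.
rewrite !sum_pair2; apply: eq_bigr => i _.
have red a : a.1 = i -> \sum_c d a * (amp es_freq a / es_freq a) * amp es_freq c *
     (d c * osc_mean es_freq es_shift a c) =
   2 * d a * (d (i, ord0) * osc_mean es_freq es_shift a (i, ord0) +
     d (i, ord_max) * osc_mean es_freq es_shift a (i, ord_max)).
  move=> ai; rewrite sum_pair2 (bigD1 i)//= big1 ?addr0; last first.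
    by move=> k ki; rewrite !other/= ?ai 1?eq_sym// !mulr0 addr0.
  have E c : c.1 = i -> amp es_freq c = amp es_freq a.
    by move=> ci; rewrite /amp /es_freq ci ai.
  rewrite !E// -(amp_sq a); ring.
rewrite !red//= /osc_mean /cc_mean /es_freq/= eqxx /es_shift/=.
rewrite !subr0 !sub0r add0r subrr addrK cosN cos0 cos_pihalf -splitr cospi.
by field.
Qed.

Lemma es_excitation gam :
  (forall v : V, gam * enorm v ^+ 2 <= \sum_(i < r) \sum_(j < 2) dotv (b i j) v ^+ 2) ->
  forall v : V, gam * enorm v ^+ 2 <= \sum_a dotv (es_vec a) v ^+ 2.
Proof. by move=> H v; rewrite -(pair_bigA _ (fun i j => dotv (b i j) v ^+ 2))/=. Qed.

Lemma es_rhs_field eps x tau m : 0 < J (x + xstar) ->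
  es_rhs b omega b0 J xstar eps x tau 0 m =
  osc_field es_vec es_freq es_shift J b0 eps (x + xstar) tau m.
Proof.
move=> J0; rewrite /es_rhs /osc_field !mxE summxE sum_pair2; congr (_ + _ * _).
apply: eq_bigr => i _; rewrite !mxE /u1 /u2 J0 /phase /es_vec /amp /es_freq /es_shift/= subr0.
rewrite -[ln _ + _ - pi / 2]/(_ - _) cosBpihalf.
have w0 : 0 <= 2 * ratr (omega i) :> R by rewrite mulr_ge0// ler0q ltW.
by rewrite (sqrtrM _ w0); ring.
Qed.

Lemma J_continuous : continuous J.
Proof.
move=> x; apply/(@cvgrPdist_le _ _ _ (nbhs x)) => e e0.
pose N : R := n%:R; pose G := enorm (grad J x).
have G0 : 0 <= G by exact: enorm_ge0.
have N0 : 0 <= N by exact: ler0n.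
have c0 : 0 < G * N + L * N ^+ 2 + 1.
  by have := mulr_ge0 G0 N0; have := mulr_ge0 (ltW L_gt0) (sqr_ge0 N); lra.
pose m := Num.min 1 (e / (G * N + L * N ^+ 2 + 1)).
have m0 : 0 < m by rewrite lt_min ltr01 divr_gt0.
near=> y.
have xy : `|x - y| < m by near: y; have := nbhsx_ballx x _ m0; rewrite -ball_normE.
move: xy; rewrite lt_min => /andP[xy1 xy2].
move: xy2; rewrite ltr_pdivlMr// => xy2.
have := taylor2 JC2 L_gt0 JL x y.
have S1 : \sum_k `|y 0 k - x 0 k| <= N * `|x - y|.
  rewrite distrC (eq_bigr (fun k => `|(y - x) 0 k|)); last by move=> k _; rewrite coordB.
  exact: (sum_coord_le (normr_coord (y - x))).
have D : `|dotv (grad J x) (y - x)| <= G * (N * `|x - y|).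
  apply: le_trans (norm_dotv_le _ _) _; rewrite ler_wpM2l// distrC; exact: enorm_le_normr.
move: S1 xy1 xy2 D; set S := \sum_k _; set z := `|x - y| => S1 xy1 xy2 D T.
have S0 : 0 <= S by apply: sumr_ge0 => k _; exact: normr_ge0.
have z0 : 0 <= z by exact: normr_ge0.
have S2 : L * S ^+ 2 <= L * (N ^+ 2 * z).
  rewrite ler_wpM2l ?(ltW L_gt0)//; apply: (@le_trans _ _ ((N * z) ^+ 2)).
    by rewrite lerXn2r// nnegrE// mulr_ge0.
  rewrite exprMn ler_wpM2l ?sqr_ge0// expr2; nra.
rewrite distrC -(subrK (dotv (grad J x) (y - x)) (J y - J x)).
apply: le_trans (ler_normD _ _) _; apply: le_trans (lerD T D) _; nra.
Unshelve. all: by end_near. Qed.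

Lemma es_rhs_continuous eps tau0 c : continuous (fun p : R * V =>
  es_rhs b omega b0 J xstar eps p.2 (tau0 + c * p.1)).
Proof.
move=> p.
have cx : (fun q : R * V => q.2 + xstar) @ nbhs p --> p.2 + xstar.
  by apply: cvgD; [exact: cvg_snd | exact: cvg_cst].
have cJ : (fun q : R * V => J (q.2 + xstar)) @ nbhs p --> J (p.2 + xstar).
  exact: (@cvg_comp _ _ _ (fun q : R * V => q.2 + xstar) J _ (nbhs (p.2 + xstar)) _ cx (@J_continuous _)).
have ct : (fun q : R * V => tau0 + c * q.1) @ nbhs p --> tau0 + c * p.1.
  apply: cvgD; first exact: cvg_cst.
  by apply: cvgM; [exact: cvg_cst | exact: cvg_fst].
have cb : (fun q : R * V => b0 (q.2 + xstar)) @ nbhs p --> b0 (p.2 + xstar).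
  apply: (@cvg_comp _ _ _ (fun q : R * V => q.2 + xstar) b0 _ (nbhs (p.2 + xstar)) _ cx).
  apply/(@cvgrPdist_le _ _ _ (nbhs (p.2 + xstar))) => e e0.
  have c0 : 0 < L0 * n%:R + 1 by rewrite ltr_wpDl// mulr_ge0// ltW.
  have m0 : 0 < e / (L0 * n%:R + 1) by rewrite divr_gt0.
  near=> y.
  have : `|p.2 + xstar - y| < e / (L0 * n%:R + 1).
    by near: y; have := nbhsx_ballx (p.2 + xstar) _ m0; rewrite -ball_normE.
  rewrite ltr_pdivlMr// => xy.
  apply: le_trans (normr_le_enorm _) _; apply: le_trans (b0_lip _ _) _.
  apply: le_trans (ler_wpM2l (ltW L0_gt0) (enorm_le_normr _)) _.
  have : 0 <= `|p.2 + xstar - y| by [].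
  rewrite mulrA; nra.
have cu (g : R -> R) w : continuous g -> (forall s, `|g s| <= 1) ->
  (fun q : R * V => if 0 < J (q.2 + xstar) then Num.sqrt (2 * w * J (q.2 + xstar)) *
     g (ln (J (q.2 + xstar)) + w * (tau0 + c * q.1)) else 0) @ nbhs p -->
  (if 0 < J (p.2 + xstar) then Num.sqrt (2 * w * J (p.2 + xstar)) *
     g (ln (J (p.2 + xstar)) + w * (tau0 + c * p.1)) else 0).
  move=> cg g1.
  apply: (@continuous2_cvg _ _ _ _ (nbhs p) _ (fun q : R * V => J (q.2 + xstar))
     (fun q : R * V => tau0 + c * q.1)
     (fun j s => if 0 < j then Num.sqrt (2 * w * j) * g (ln j + w * s) else 0)) => //.
  exact: (@continuous_u R g w cg g1 (J (p.2 + xstar), tau0 + c * p.1)).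
apply: cvgD => //; apply: cvgZr.
apply: (cvg_big (op := +%R)) => [|i _]; first exact: add_continuous.
apply: cvgD; apply: cvgZl.
  by apply: cu; [exact: continuous_cos | move=> s; rewrite ler_norml cos_geN1 cos_le1].
by apply: cu; [exact: continuous_sin | move=> s; rewrite ler_norml sin_geN1 sin_le1].
Unshelve. all: by end_near. Qed.

Lemma grad_le_enorm x :
  enorm (grad J x) <= 4 * L * n.+1%:R ^+ 2 * enorm (x - xstar).
Proof.
set C := 4 * L * _ ^+ 2.
have C0 : 0 <= C by rewrite /C; have := mulr_ge0 (ltW L_gt0) (sqr_ge0 (n.+1%:R : R)); rewrite -mulrA; lra.
have H1 := sqr_grad_le JC2 L_gt0 JL Jmin x.
have H2 := J_le_sqr JC2 L_gt0 JL grad0 x.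
rewrite -/C in H1 H2.
have E0 : 0 <= C * enorm (x - xstar) by exact: mulr_ge0 C0 (enorm_ge0 _).
rewrite -(ler_pXn2r (n := 2))// ?nnegrE ?enorm_ge0//.
apply: le_trans H1 _; rewrite exprMn [C ^+ 2]expr2 -[leRHS]mulrA.
exact: ler_wpM2l.
Qed.

(** J grows at most quadratically, so its square root grows linearly. The constant depends on [eps],
    which is harmless: it serves existence and continuation only. *)
Lemma es_rhs_growth eps : 0 < eps ->
  exists2 K, 0 <= K & forall x tau, `|es_rhs b omega b0 J xstar eps x tau| <= K * (1 + `|x|).
Proof.
move=> e0; pose N : R := n%:R; pose C := 4 * L * n.+1%:R ^+ 2.
have N0 : 0 <= N by exact: ler0n.
have C0 : 0 <= C by rewrite /C; have := mulr_ge0 (ltW L_gt0) (sqr_ge0 (n.+1%:R : R)); rewrite -mulrA; lra.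
pose A w : R := Num.sqrt (2 * w * (`|J xstar| + C)) * (1 + N).
have rho (x : V) : enorm (x + xstar - xstar) <= N * `|x| by rewrite addrK enorm_le_normr.
have JA x : J (x + xstar) <= (`|J xstar| + C) * (1 + N * `|x|) ^+ 2.
  have := J_le_sqr JC2 L_gt0 JL grad0 (x + xstar); rewrite -/C.
  have := rho x; set q := enorm _ => qx.
  have q2 : q ^+ 2 <= (N * `|x|) ^+ 2 by rewrite lerXn2r// nnegrE ?enorm_ge0// mulr_ge0.
  have := ler_wpM2l C0 q2; have := ler_norm (J xstar); have : 0 <= N * `|x| by rewrite mulr_ge0.
  have : 0 <= `|J xstar| by [].
  set z := N * `|x| => j0 z0 j1 h1 h2.
  have := mulr_ge0 j0 z0; have := mulr_ge0 j0 (sqr_ge0 z); have := mulr_ge0 C0 z0.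
  rewrite expr2 in h1 *; rewrite expr2; nra.
have NA (x : V) : 1 + N * `|x| <= (1 + N) * (1 + `|x|).
  by have : 0 <= `|x| by []; nra.
have uA (g : R) w x : 0 <= w -> `|g| <= 1 ->
   `|if 0 < J (x + xstar) then Num.sqrt (2 * w * J (x + xstar)) * g else 0| <= A w * (1 + `|x|).
  move=> w0 g1; have A0 : 0 <= A w * (1 + `|x|).
    by rewrite !mulr_ge0 ?sqrtr_ge0 ?addr_ge0.
  case: ifPn => [J0|_]; last by rewrite normr0.
  rewrite normrM (ger0_norm (sqrtr_ge0 _)).
  apply: (@le_trans _ _ (Num.sqrt (2 * w * J (x + xstar)))); first by rewrite ler_piMr ?sqrtr_ge0.
  rewrite /A -[leRHS]mulrA.
  apply: (@le_trans _ _ (Num.sqrt (2 * w * (`|J xstar| + C)) * (1 + N * `|x|))); last first.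
    exact: ler_wpM2l (sqrtr_ge0 _) _ _ (NA x).
  have z0 : 0 <= 1 + N * `|x| by rewrite addr_ge0// mulr_ge0.
  have zE : 1 + N * `|x| = Num.sqrt ((1 + N * `|x|) ^+ 2) by rewrite sqrtr_sqr ger0_norm.
  have w2 : 0 <= 2 * w * (`|J xstar| + C) by rewrite !mulr_ge0// addr_ge0.
  rewrite [leRHS](_ : _ = Num.sqrt (2 * w * (`|J xstar| + C) * (1 + N * `|x|) ^+ 2)); last first.
    by rewrite (sqrtrM _ w2) -zE.
  by apply: ler_wsqrtr; rewrite -[leRHS]mulrA ler_wpM2l// mulr_ge0.
pose K := kappa * (C * N) + eps^-1 *
  \sum_i (A (ratr (omega i)) * `|b i ord0| + A (ratr (omega i)) * `|b i ord_max|).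
have A_ge0 w : 0 <= A w by rewrite mulr_ge0 ?sqrtr_ge0 ?addr_ge0.
have S0 : 0 <= \sum_i (A (ratr (omega i)) * `|b i ord0| + A (ratr (omega i)) * `|b i ord_max|).
  by apply: sumr_ge0 => i _; rewrite addr_ge0// mulr_ge0.
have ei : 0 <= eps^-1 by rewrite invr_ge0 ltW.
exists K; first exact: addr_ge0 (mulr_ge0 kappa_ge0 (mulr_ge0 C0 N0)) (mulr_ge0 ei S0).
move=> x tau; rewrite /es_rhs /K mulrDl; apply: le_trans (ler_normD _ _) _; apply: lerD.
  apply: le_trans (normr_le_enorm _) _; apply: le_trans (b0_le _) _.
  rewrite -[leRHS]mulrA ler_wpM2l//; apply: le_trans (grad_le_enorm _) _.
  rewrite -/C -[leRHS]mulrA ler_wpM2l//; apply: le_trans (rho x) _.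
  by rewrite ler_wpM2l// lerDr.
rewrite normrZ ger0_norm// -[leRHS]mulrA ler_wpM2l// mulr_suml.
apply: le_trans (ler_norm_sum _ _ _) _; apply: ler_sum => i _.
have w0 : 0 <= ratr (omega i) :> R by rewrite ler0q ltW.
apply: le_trans (ler_normD _ _) _; rewrite mulrDl; apply: lerD; rewrite normrZ mulrAC ler_wpM2r//.
  by apply: uA => //; rewrite ler_norml cos_geN1 cos_le1.
by apply: uA => //; rewrite ler_norml sin_geN1 sin_le1.
Qed.

End ESSystem.

(** * Global solutions and bounds uniform in the initial condition *)

Section ESBounds.
Variables (R : realType) (n r : nat) (b : 'I_r -> 'I_2 -> 'rV[R]_n).
Variables (omega : 'I_r -> rat) (b0 : 'rV[R]_n -> 'rV[R]_n) (J : 'rV[R]_n -> R).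
Variables (xstar : 'rV[R]_n) (L L0 kappa gam : R) (alpha : R -> R).
Hypothesis omega_gt0 : forall i, 0 < omega i.
Hypothesis omega_inj : injective omega.
Hypothesis JC2 : C2 J.
Hypothesis L_gt0 : 0 < L.
Hypothesis JL : forall x, hess_norm J x <= L.
Hypothesis Jmin : forall x, J xstar <= J x.
Hypothesis grad0 : grad J xstar = 0.
Hypothesis kappa_ge0 : 0 <= kappa.
Hypothesis b0_le : forall x, enorm (b0 x) <= kappa * enorm (grad J x).
Hypothesis L0_gt0 : 0 < L0.
Hypothesis b0_lip : forall x y, enorm (b0 x - b0 y) <= L0 * enorm (x - y).
Hypothesis excitation : forall v : 'rV[R]_n,
  gam * enorm v ^+ 2 <= \sum_(i < r) \sum_(j < 2) dotv (b i j) v ^+ 2.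
Hypothesis kappa_lt : kappa < gam.
Hypothesis alphaK : classK alpha.
Hypothesis alpha_grad : forall x,
  alpha (enorm (x - xstar)) ^+ 2 * enorm (x - xstar) ^+ 2 <= enorm (grad J x) ^+ 2.
Local Notation V := 'rV[R]_n.
Local Notation solution := (es_solution b omega b0 J xstar).

Let infinite_horizon :
  [set t : R | 0 <= t /\ (t%:E < +oo)%E] = [set t : R | 0 <= t].
Proof. by apply/seteqP; split => t /= => [[]//|t0]; split => //; rewrite ltry. Qed.

Let continuous_affine (a c : R) : continuous (fun t : R => a + c * t).
Proof.
by move=> t; apply: cvgD; [exact: cvg_cst | apply: cvgM; [exact: cvg_cst | exact: cvg_id]].
Qed.

Let es_solution_infinite (eps tau0 : R) (x0 : V) (x : R -> V) : x 0 = x0 ->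
  {within [set t : R | 0 <= t], continuous x} ->
  (forall t : R, 0 < t ->
     is_derive t 1 x (es_rhs b omega b0 J xstar eps (x t) (tau0 + eps ^- 2 * t))) ->
  solution eps x0 tau0 +oo%E x (fun t => tau0 + eps ^- 2 * t).
Proof.
move=> x00 xc dx; split; first by [].
split=> //; split; first by rewrite mulr0 addr0.
rewrite infinite_horizon; split=> //; split.
  by apply: continuous_subspaceT; exact: continuous_affine.
move=> t t0 _; have [dxt xt] := dx t t0.
have dtau : is_derive t 1 (fun t : R => tau0 + eps ^- 2 * t) (eps ^- 2).
  have := is_derive_add (is_derive_cst tau0 t 1)
    (is_derive_cmul (eps ^- 2) (is_derive_id t 1)).
  by rewrite add0r mulr1.
have [dt tt] := dtau.
by rewrite !derive1E.
Qed.

Lemma es_existence eps (x0 : V) (tau0 : R) : 0 < eps ->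
  exists x tau, solution eps x0 tau0 +oo%E x tau.
Proof.
move=> e0.
have [K K0 HK] := es_rhs_growth b omega_gt0 JC2 L_gt0 JL Jmin grad0 kappa_ge0 b0_le e0.
have Fc : continuous (fun p : R * V =>
    es_rhs b omega b0 J xstar eps p.2 (tau0 + eps ^- 2 * p.1)).
  exact (@es_rhs_continuous R n r b omega b0 J xstar L L0 JC2 L_gt0 JL L0_gt0 b0_lip
    eps tau0 (eps ^- 2)).
have [x [x00 xc dx]] := peano x0 K0 (fun t x => HK x (tau0 + eps ^- 2 * t)) Fc.
exists x, (fun t => tau0 + eps ^- 2 * t); apply: es_solution_infinite => //.
exact: continuous_subspaceT.
Qed.

(** Reduces the system to a nonautonomous equation for [x] alone, the form in which solutions are
    continued. *)
Let solution_tau eps (x0 : V) tau0 ts x tau : solution eps x0 tau0 ts x tau ->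
  forall t : R, 0 <= t -> (t%:E < ts)%E -> tau t = tau0 + eps ^- 2 * t.
Proof.
move=> [_ [_ [tau00 [_ [tauc dx]]]]] t t0 tts.
pose h (s : R) := tau s - eps ^- 2 * s.
have dh (s : R) : s \in `]0, t[%R -> is_derive s 1 h (eps ^- 2 - eps ^- 2 * 1).
  rewrite in_itv/= => /andP[s0 st].
  have sts : (s%:E < ts)%E by apply: lt_trans tts; rewrite lte_fin.
  have [_ [_ [dtau tau']]] := dx s s0 sts.
  have Dt : is_derive s 1 tau (eps ^- 2) by constructor; rewrite // -derive1E.
  exact: is_derive_sub Dt (is_derive_cmul _ (is_derive_id s 1)).
have hc : {within `[0, t], continuous h}.
  have tc : {within `[0, t], continuous tau}.
    apply: continuous_subspaceW tauc => s; rewrite /= in_itv/= => /andP[s0 st].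
    by split=> //; apply: le_lt_trans tts; rewrite lee_fin.
  move=> s; apply: cvgB; first exact: tc.
  have : {within `[0, t], continuous (fun s : R => eps ^- 2 * s)}.
    by apply: continuous_subspaceT; exact: mulrl_continuous.
  exact.
have [c _] := MVT_segment t0 dh hc.
rewrite mulr1 subrr mul0r /h mulr0 tau00 subr0; lra.
Qed.

Lemma es_extension eps (x0 : V) tau0 ts x tau : 0 < eps ->
  solution eps x0 tau0 ts x tau ->
  exists x' tau', solution eps x0 tau0 +oo%E x' tau' /\
    forall t : R, 0 <= t -> (t%:E < ts)%E -> x' t = x t /\ tau' t = tau t.
Proof.
move=> e0 Hs; have tauE := solution_tau Hs.
case: ts Hs tauE => [T| |] Hs tauE; last by case: Hs; rewrite ltNge leNye.
  have [T0 [x00 [_ [xc [_ dx]]]]] := Hs; rewrite lte_fin in T0.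
  have [K K0 HK] := es_rhs_growth b omega_gt0 JC2 L_gt0 JL Jmin grad0 kappa_ge0 b0_le e0.
  have Fc : continuous (fun p : R * V =>
      es_rhs b omega b0 J xstar eps p.2 (tau0 + eps ^- 2 * p.1)).
    exact (@es_rhs_continuous R n r b omega b0 J xstar L L0 JC2 L_gt0 JL L0_gt0 b0_lip
    eps tau0 (eps ^- 2)).
  have xc' : {within [set t : R | 0 <= t < T], continuous x}.
    by apply: continuous_subspaceW xc => t /= /andP[t0 tT]; rewrite lte_fin.
  have dx' (t : R) : 0 < t < T ->
      is_derive t 1 x (es_rhs b omega b0 J xstar eps (x t) (tau0 + eps ^- 2 * t)).
    move=> /andP[t0 tT]; have tT' : (t%:E < T%:E)%E by rewrite lte_fin.
    have [d1 [d2 _]] := dx t t0 tT'.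
    by rewrite -(tauE t (ltW t0) tT'); constructor; rewrite // -derive1E.
  have [z [zx zc dz]] := solution_extension K0 (fun t x => HK x (tau0 + eps ^- 2 * t)) Fc T0 xc' dx'.
  exists z, (fun t => tau0 + eps ^- 2 * t); split.
    by apply: es_solution_infinite => //; rewrite zx.
  by move=> t t0 tT; rewrite tauE//; split=> //; apply: zx; rewrite -lte_fin.
by exists x, tau.
Qed.

Let C1 : R := 4 * L * n.+1%:R ^+ 2.

Let C1_gt0 : 0 < C1.
Proof. by rewrite /C1 !mulr_gt0// exprn_gt0. Qed.

Let gap x : R := J x - J xstar.

Let gap_ge0 x : 0 <= gap x. Proof. by rewrite subr_ge0. Qed.

Let sqr_grad_le_gap x : enorm (grad J x) ^+ 2 <= C1 * gap x.
Proof. exact (sqr_grad_le JC2 L_gt0 JL Jmin x). Qed.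

Let gap_le x : gap x <= C1 * enorm (x - xstar) ^+ 2.
Proof. exact (J_le_sqr JC2 L_gt0 JL grad0 x). Qed.

Let gain_le_grad x : gain alpha (enorm (x - xstar)) <= enorm (grad J x) ^+ 2.
Proof. by rewrite /gain ger0_norm ?enorm_ge0// exprMn. Qed.

Let gain_le_gap x : gain alpha (enorm (x - xstar)) <= C1 * gap x.
Proof. exact: le_trans (gain_le_grad x) (sqr_grad_le_gap x). Qed.

(** [r0] and [c] enter the comparison constants here, and through them the threshold on [eps], but
    not the decay rate. *)
Lemma region_comparable (r0 c : R) : 0 < r0 -> 0 < c ->
  (forall x, r0 <= enorm (x - xstar) -> c <= J x) ->
  exists c2 c3 : R, [/\ 0 <= c2, 0 <= c3 &
    forall x, r0 <= enorm (x - xstar) -> comparable_region J c2 c3 x].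
Proof.
move=> r00 c0 Jc.
have ar0 : 0 < alpha r0 by have [a0 [_ ai]] := alphaK; rewrite -a0 ai.
(* [k2] comes from J <= |J xstar| + C1 q^2 with [q >= r0] and alpha(r0) q <= |grad J|; [k3] from
   |grad J|^2 <= C1 (J - J xstar) with J >= c. *)
pose k2 := (C1 + `|J xstar| / r0 ^+ 2) / alpha r0 ^+ 2.
pose k3 := C1 * (1 + `|J xstar| / c).
have k20 : 0 <= k2.
  exact: divr_ge0 (addr_ge0 (ltW C1_gt0) (divr_ge0 (normr_ge0 _) (sqr_ge0 _))) (sqr_ge0 _).
have k30 : 0 <= k3.
  apply: mulr_ge0 (ltW C1_gt0) _; apply: addr_ge0 => //; exact: divr_ge0 (normr_ge0 _) (ltW c0).
exists (Num.sqrt k2), (Num.sqrt k3); split; rewrite ?sqrtr_ge0// => x xr.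
have Jx := Jc x xr; have J0 : 0 < J x by exact: lt_le_trans Jx.
have V1 := gap_le x; have V2 := sqr_grad_le_gap x.
have ag := gain_le_grad x; rewrite /gain ger0_norm ?enorm_ge0// in ag.
set q := enorm (x - xstar) in xr V1 ag.
set G := enorm _ in ag V2 *.
have q0 : 0 < q by exact: lt_le_trans xr.
split=> //.
  rewrite -[X in _ * X]ger0_norm ?enorm_ge0// -sqrtr_sqr -sqrtrM//.
  apply: ler_wsqrtr.
  have ar : alpha r0 <= alpha q by apply: classK_le => //; exact: ltW.
  have h1 : alpha r0 ^+ 2 * q ^+ 2 <= G ^+ 2.
    apply: le_trans ag; rewrite -exprMn lerXn2r ?nnegrE ?mulr_ge0 ?(ltW q0) ?(ltW ar0)//.
      exact: le_trans (ltW ar0) ar.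
    by rewrite ler_wpM2r// ltW.
  apply: (@le_trans _ _ (k2 * (alpha r0 ^+ 2 * q ^+ 2))); last by rewrite ler_wpM2l.
  have -> : k2 * (alpha r0 ^+ 2 * q ^+ 2) = C1 * q ^+ 2 + `|J xstar| * (q ^+ 2 / r0 ^+ 2).
    by rewrite /k2; field; rewrite !gt_eqF.
  have qr : 1 <= q ^+ 2 / r0 ^+ 2.
    by rewrite ler_pdivlMr ?exprn_gt0// mul1r lerXn2r// nnegrE ltW.
  have := ler_norm (J xstar); have := ler_wpM2l (normr_ge0 (J xstar)) qr.
  by rewrite mulr1; move: V1; rewrite /gap; lra.
rewrite -/G -sqrtrM// -[G]ger0_norm ?enorm_ge0// -sqrtr_sqr; apply: ler_wsqrtr.
apply: le_trans V2 _; rewrite /k3 -[leRHS]mulrA ler_wpM2l ?(ltW C1_gt0)//.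
have h : `|J xstar| <= `|J xstar| / c * J x.
  by rewrite mulrAC ler_pdivlMr// ler_wpM2l.
have := ler_norm (- J xstar); rewrite normrN /gap mulrDl; lra.
Qed.

(** [beta] is given beforehand and its conditions mention neither [r0] nor [Delta], so the same
    function serves every radius, as practical stability demands. *)
Lemma es_bound (r0 c Delta : R) (beta : R -> R -> R) : 0 < r0 -> 0 < c ->
  (forall x, r0 <= enorm (x - xstar) -> c <= J x) ->
  r0 <= Delta -> 3 * C1 ^+ 2 * r0 ^+ 2 <= gain alpha Delta ->
  (forall s t q : R, 0 <= t -> 0 <= q -> gain alpha q <= 3 * C1 ^+ 2 * s ^+ 2 ->
    t * ((gam - kappa) / 2 * gain alpha (Num.sqrt (gain alpha q / (4 * C1 ^+ 2))))
      <= 3 / 2 * C1 * s ^+ 2 -> q <= beta s t) ->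
  exists epsS : R, 0 < epsS /\ forall eps : R, 0 < eps -> eps < epsS ->
    es_bounded b omega b0 J xstar eps (fun s t => beta s t + Delta).
Proof.
move=> r00 c0 Jc rD gD Hbeta.
have [c2 [c3 [c20 c30 Hreg]]] := region_comparable r00 c0 Jc.
have k0 : 0 < (gam - kappa) / 2 by rewrite divr_gt0// subr_gt0.
have [epsS epsS0 Havg] := averaged_lyapunov (es_freq_gt0 R omega_gt0) JC2 L_gt0 JL Jmin
  kappa_ge0 b0_le (es_excitation excitation) (es_mean_quad omega_gt0 omega_inj)
  c20 c30 C1_gt0 sqr_grad_le_gap kappa_lt.
exists epsS; split=> // eps e0 eS; have [Hclose Hder] := Havg eps e0 eS.
have global (x0 : V) (tau0 : R) x tau : solution eps x0 tau0 +oo%E x tau ->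
    forall t, 0 <= t -> enorm (x t) <= beta (enorm x0) t + Delta.
  move=> [_ [x00 [_ [xc [_ dx]]]]] t t0; rewrite infinite_horizon in xc.
  (* A solution is continuous on the half-line only; freezing it at negative times gives a curve on
     the whole line. *)
  pose y (s : R) := x (Num.max s 0).
  have yc : continuous y by exact: continuous_clamp.
  have yE (s : R) : 0 <= s -> y s = x s by move=> s0; rewrite /y (max_idPl s0).
  pose rho s := enorm (y s).
  have rhoE s : enorm (y s + xstar - xstar) = rho s by rewrite addrK.
  pose U s := J (zmap (es_vec b) (es_freq R omega) (@es_shift R r) J eps (x s + xstar) (tau s))
                - J xstar.
  have rho_cont : continuous rho.
    move=> s; apply: (@continuous_comp _ _ _ (fun s => \sum_i y s 0 i ^+ 2) Num.sqrt);
      last exact: sqrt_continuous.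
    apply: (cvg_big (op := +%R)) => [|i _]; first exact: add_continuous.
    apply: (@continuous_comp _ _ _ (fun s => y s 0 i) (fun v : R => v ^+ 2));
      last exact: exprn_continuous.
    by apply: (@continuous_comp _ _ _ y (fun v : V => v 0 i)); [exact: yc | exact: coord_continuous].
  have W_cont : continuous (fun s => gap (y s + xstar)).
    move=> s; apply: cvgB; last exact: cvg_cst.
    apply: (@continuous_comp _ _ _ (fun s => y s + xstar) J); last exact: (J_continuous JC2 L_gt0 JL).
    by apply: cvgD; [exact: yc | exact: cvg_cst].
  have U_W u : 0 < u -> r0 <= rho u ->
      gap (y u + xstar) / 2 <= U u <= 3 / 2 * gap (y u + xstar).
    move=> u0 ur; have := Hclose (x u + xstar) (tau u).
    rewrite -(yE u (ltW u0)) => /(_ (Hreg _ _)); rewrite rhoE => /(_ ur).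
    rewrite /U -(yE u (ltW u0)) -/(gap _) ler_norml => /andP[h1 h2].
    by apply/andP; split; move: h1 h2; rewrite /gap; lra.
  have dU_U u : 0 < u -> r0 <= rho u -> exists2 D, is_derive u 1 U D &
      D <= - ((gam - kappa) / 2 * gain alpha (rho u)).
    move=> u0 ur.
    have reg : comparable_region J c2 c3 (x u + xstar).
      by apply: Hreg; rewrite -(yE u (ltW u0)) rhoE.
    have [dxu [xE [dtau tauE]]] := dx u u0 (ltry u).
    have Ht : is_derive u 1 tau (eps ^- 2) by constructor; rewrite // -derive1E.
    have Hx : is_derive u 1 x (es_rhs b omega b0 J xstar eps (x u) (tau u)).
      by constructor; rewrite // -derive1E.
    have Hx' m : is_derive u 1 (fun s => (x s + xstar) 0 m)
       (osc_field (es_vec b) (es_freq R omega) (@es_shift R r) J b0 eps (x u + xstar) (tau u) m).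
      rewrite -es_rhs_field//; last by case: reg.
      have := is_derive_add ((is_derive_rowP _ _ _).1 Hx m) (is_derive_cst (xstar 0 m) u 1).
      rewrite addr0 (_ : (fun s => (x s + xstar) 0 m) = (fun s => x s 0 m + xstar 0 m))//.
      by apply/funext => s; rewrite mxE.
    have [D HD DD] := Hder (fun s => x s + xstar) tau u Ht Hx' reg.
    exists D.
      by have := is_derive_sub HD (is_derive_cst (J xstar) u 1); rewrite subr0.
    apply: le_trans DD _; rewrite lerN2 ler_wpM2l ?(ltW k0)//.
    by rewrite -rhoE yE ?(ltW u0)// gain_le_grad.
  (* ['D_1 U] is total, and wherever the solution is outside the ball it equals the derivative
     supplied by [dU_U]. *)
  have Hb := @trajectory_bound R alpha rho (fun s => gap (y s + xstar)) U
    (fun u => 'D_1 U u) C1 ((gam - kappa) / 2) r0 alphaK C1_gt0 k0 (fun s => enorm_ge0 _)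
    rho_cont W_cont.
  have := Hb _ _ U_W _ _ beta Delta t Hbeta (ltW r00) rD gD t0.
  rewrite /rho (yE 0 (lexx _)) x00 (yE t t0); apply.
  - by move=> u; have := gap_le (y u + xstar); rewrite rhoE.
  - by move=> u; have := gain_le_gap (y u + xstar); rewrite rhoE.
  - by move=> u u0 ur; have [D HD _] := dU_U u u0 ur; have [dU UD] := HD; constructor.
  - by move=> u u0 ur; have [D [_ <-]] := dU_U u u0 ur.
move=> x0 tau0 tau00; split; first exact: es_existence.
(* A solution on a bounded interval is a restriction of a global one and inherits its bound. *)
move=> ts x tau Hs; have [x' [tau' [Hs' E]]] := es_extension e0 Hs.
split; first by exists x', tau'.
by move=> t t0 tts; have [<- _] := E t t0 tts; exact: global Hs' t t0.
Qed.

End ESBounds.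

Theorem theorem2 (R : realType) (n r : nat)
  (b : 'I_r -> 'I_2 -> 'rV[R]_n) (omega : 'I_r -> rat)
  (b0 : 'rV[R]_n -> 'rV[R]_n) (J : 'rV[R]_n -> R) (xstar : 'rV[R]_n)
  (gamma kappa3 : R)
  (* data *)
  (Hn : (0 < n)%N) (Hr : (0 < r)%N) (Hrn : (n <= 2 * r)%N)
  (Homega_pos : forall i, 0 < omega i) (Homega_inj : injective omega)
  (Hmin : forall x, J xstar <= J x)
  (* Excitation Assumption with constant gamma *)
  (Hgamma : 0 < gamma)
  (Hexc : forall v : 'rV[R]_n,
     gamma * enorm v ^+ 2 <= \sum_(i < r) \sum_(j < 2) dotv (b i j) v ^+ 2)
  (* Regularity Assumption with constant kappa3 *)
  (HJ_C2 : C2 J)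
  (Hreg_a : forall x, x != xstar -> J xstar < J x)
  (Hreg_b : forall x, grad J x = 0 <-> x = xstar)
  (Hreg_c : exists LJ : R, 0 < LJ /\ forall x, hess_norm J x <= LJ)
  (Hkappa3 : 0 < kappa3)
  (Hreg_d : forall x, enorm (b0 x) <= kappa3 * enorm (grad J x))
  (Hreg_e : exists L0 : R, 0 < L0 /\
     forall x1 x2, enorm (b0 x1 - b0 x2) <= L0 * enorm (x1 - x2))
  (* further hypotheses *)
  (Hgk : kappa3 < gamma)
  (Hrad : radially_unbounded J)
  (HalphaJ : exists alphaJ : R -> R, classK alphaJ /\
     forall x, alphaJ (enorm (x - xstar)) ^+ 2 * enorm (x - xstar) ^+ 2
               <= enorm (grad J x) ^+ 2) :
  (exists Delta : R, 0 < Delta /\ UGUB b omega b0 J xstar Delta) /\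
  (0 <= J xstar -> UGPAS b omega b0 J xstar).
Proof.
have [L [L_gt0 JL]] := Hreg_c.
have [L0 [L0_gt0 b0_lip]] := Hreg_e.
have [alpha [alphaK alpha_grad]] := HalphaJ.
have grad0 : grad J xstar = 0 by exact/Hreg_b.
have k0 : 0 < (gamma - kappa3) / 2 by rewrite divr_gt0// subr_gt0.
pose C1 : R := 4 * L * n.+1%:R ^+ 2.
have C1_gt0 : 0 < C1 by rewrite /C1 !mulr_gt0// exprn_gt0.
have C1_sq : 0 < C1 ^+ 2 by rewrite exprn_gt0.
have [beta betaKL Hbeta] := @exists_gain_KL _ _ alphaK (3 * C1 ^+ 2) (4 * C1 ^+ 2)
  (3 / 2 * C1) ((gamma - kappa3) / 2) ltac:(lra) ltac:(lra) ltac:(lra) k0.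
have bound (r0 c Delta : R) (r00 : 0 < r0) (c0 : 0 < c) Jc rD gD :=
  @es_bound R n r b omega b0 J xstar L L0 kappa3 gamma alpha Homega_pos Homega_inj
    HJ_C2 L_gt0 JL Hmin grad0 (ltW Hkappa3) Hreg_d L0_gt0 b0_lip Hexc Hgk alphaK
    alpha_grad r0 c Delta beta r00 c0 Jc rD gD Hbeta.
have gain_J x : gain alpha (enorm (x - xstar)) <= C1 * (J x - J xstar).
  apply: le_trans (sqr_grad_le HJ_C2 L_gt0 JL Hmin x).
  by rewrite /gain ger0_norm ?enorm_ge0// exprMn.
split.
(* Beyond [r1] the gain forces J - J xstar >= |J xstar| + 1, hence J >= 1, whatever the sign of
   [J xstar]. *)
- have [r1 r10 Hr1] := gain_unbounded alphaK (C1 * (`|J xstar| + 1)).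
  pose r0 := Num.max r1 1.
  have r0_gt0 : 0 < r0 by rewrite lt_max ltr01 orbT.
  have [d d0 Hd] := gain_unbounded alphaK (3 * C1 ^+ 2 * r0 ^+ 2).
  pose Delta := Num.max d r0.
  have rD : r0 <= Delta by rewrite le_max lexx orbT.
  exists Delta; split; first exact: lt_le_trans rD.
  exists beta; split=> //; apply: (bound r0 1 Delta) => //.
    move=> x xr; have := gain_J x.
    have g1 : gain alpha r1 <= gain alpha (enorm (x - xstar)).
      by apply: gain_le => //; apply: le_trans xr; rewrite le_max lexx.
    move=> /(le_trans (le_trans Hr1 g1)); rewrite ler_pM2l//.
    have := ler_norm (- J xstar); rewrite normrN; lra.
  by apply: le_trans Hd _; apply: gain_le => //; rewrite le_max lexx.
- move=> J0; exists beta; split=> // nu nu0.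
  have gnu : 0 < gain alpha nu by rewrite -(gain0 alpha) gain_lt.
  (* The largest radius with [3 * C1 ^+ 2 * s ^+ 2 <= gain alpha nu]. As [J xstar >= 0], J is at
     least [gain alpha r0 / C1] outside the ball of radius [r0], however small. *)
  pose s := Num.sqrt (gain alpha nu / (3 * C1 ^+ 2)).
  have C3 : 0 < 3 * C1 ^+ 2 by lra.
  have s0 : 0 < s by rewrite sqrtr_gt0 divr_gt0.
  pose r0 := Num.min nu s.
  have r0_gt0 : 0 < r0 by rewrite lt_min nu0.
  have gr0 : 0 < gain alpha r0 by rewrite -(gain0 alpha) gain_lt.
  apply: (bound r0 (gain alpha r0 / C1) nu) => //.
  + by rewrite divr_gt0.
  + move=> x xr; rewrite ler_pdivrMr// mulrC.
    have := gain_le alphaK (ltW r0_gt0) xr; have := gain_J x.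
    have := mulr_ge0 (ltW C1_gt0) J0; rewrite mulrBr; lra.
  + by rewrite ge_min lexx.
  + rewrite mulrC -ler_pdivlMr//.
    have -> : gain alpha nu / (3 * C1 ^+ 2) = s ^+ 2.
      by rewrite sqr_sqrtr// divr_ge0 ?ltW.
    by rewrite lerXn2r// ?nnegrE ?(ltW r0_gt0) ?(ltW s0)// ge_min lexx orbT.
Qed.
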